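(* Work in the setting of the context. Let $G$ have the piecewise Hölder representation $$G(\theta,z)=\sum_{i=1}^r\mathbf 1_{B_i(\theta)}(z)\,G^i(\theta,z),\qquad B_i(\theta):=\bigcap_{l=1}^{s_i}\{z\in\mathbb R^d:\Lambda_{il}(\theta,z)+a^i_l\in I_{il}\},$$ where - $r,s_1,\dots,s_r\in\mathbb N$; $a^i_l\in\mathbb R$; each $I_{il}$ is $]0,\infty[$ or $[0,\infty[$; - for each $i$, $G^i:\Theta\times\mathbb R^d\to\mathbb R$ is such that $G^i(\theta,\cdot)$ is Borel measurable and $\mathbb P^Z$-integrable for every $\theta\in\Theta$, $G^i(\theta_k,\cdot)\to G^i(\theta,\cdot)$ in $\mathbb P^Z$-probability whenever $\theta_k\to\theta$, and $|G^i(\theta,z)-G^i(\vartheta,z)|\le C^i(z)\|\theta-\vartheta\|_m^{\beta_i}$ for all $z\in\mathbb R^d$, $\theta,\vartheta\in\Theta$, with some $\beta_i\in\,]0,1]$ and some strictly positive square $\mathbb P^Z$-integrable $C^i:\mathbb R^d\to\mathbb R$; - each $\Lambda_{il}:\mathbb R^m\times\mathbb R^d\to\mathbb R$ is Borel measurable with $\Lambda_{il}(\cdot,z)$ affine linear for every $z\in\mathbb R^d$; - for every $\theta\in\Theta$ the sets $B_1(\theta),\dots,B_r(\theta)$ form a partition of $\mathbb R^d$. For $\delta>0$ let $\overline B_{i\delta}:=\bigcup_{\theta\in\mathcal U_\delta}B_i(\theta)\,\Delta\,B_i(\theta^* )$ (symmetric difference), and fix Borel sets $\widehat B_{i\delta}\supseteq\overline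 B_{i\delta}$ in $\mathbb R^d$ ($i=1,\dots,r$). Then, for every $\delta>0$, $$\xi^G_\delta(z):=\sum_{i=1}^r\big[2\delta^{\beta_i}C^i(z)+|G^i(\theta^*,z)|\,\mathbf 1_{\widehat B_{i\delta}}(z)+(\delta\wedge1)^2\big]$$ defines a positive envelope of $\mathbb F^\Theta_\delta$, and for every $\varepsilon\in\,]0,1[$ $$J(\mathbb F^\Theta_\delta,\xi^G_\delta,\varepsilon)\le2\varepsilon\sqrt{r+\ln(2)+c_{mr\varepsilon}+\big[5+2\ln(8(r+1)/\varepsilon)\big]d_{mr}}+2\varepsilon\sqrt{r+4\big[1+\ln(8(r+1)/\varepsilon)\big]d_{mr}},$$ where $c_{mr\varepsilon}:=2rm\ln(3)+m\ln(8(r+1)/\varepsilon)\sum_{i=1}^r1/\beta_i$ and $d_{mr}:=(m+2)\sum_{i=1}^rs_i$.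
   Context: $\Theta\subset\mathbb R^m$ is compact with Euclidean diameter $\Delta(\Theta)>0$; $\|\cdot\|_m$ is the Euclidean norm; $\mathbb P^Z$ is the distribution of a $d$-dimensional random vector. $\theta^*\in\Theta$ is a fixed point (in the paper, the unique solution of the stochastic program under study). $\mathcal U_\delta:=\{\theta\in\Theta:\|\theta-\theta^*\|_m\le\delta\}$; $\mathbb F^\Theta_\delta:=\{G(\theta,\cdot)-G(\theta^*,\cdot):\theta\in\mathcal U_\delta\}$; $x\wedge y=\min\{x,y\}$. A positive envelope of a class $\mathbb F$ of Borel functions on $\mathbb R^d$ is a strictly positive Borel function $C_{\mathbb F}$ with $\sup_{h\in\mathbb F}|h|\le C_{\mathbb F}$. $\|f\|_{\mathbb Q,2}=(\int f^2d\mathbb Q)^{1/2}$. $N(\eta,\mathbb F,L^2(\mathbb Q))$ is the minimal number of closed $L^2(\mathbb Q)$-balls of radius $\eta$ with centers in $\mathbb F$ needed to cover $\mathbb F$ ($\infty$ if no finite cover exists). $\mathcal M_{\rm fin}$ is the set of probability measures on $\mathcal B(\mathbb R^d)$ with finite support. $J(\mathbb F,C_{\mathbb F},\delta):=\int_0^\delta\sup_{\mathbb Q\in\mathcal M_{\rm fin}}\sqrt{\ln\big(2N(\varepsilon\|C_{\mathbb F}\|_{\mathbb Q,2},\mathbb F,L^2(\mathbb Q))\big)}\,d\varepsilon$. *)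

(* Defs.v *)
From mathcomp Require Export all_boot all_order all_algebra.
From mathcomp Require Export all_classical all_reals all_analysis.
Export Order.TTheory GRing.Theory Num.Theory.
Export numFieldNormedType.Exports.

Set Implicit Arguments.
Unset Strict Implicit.
Unset Printing Implicit Defensive.

Local Open Scope classical_set_scope.
Local Open Scope ring_scope.

Notation borel T := (g_sigma_algebraType (@open T)).

(* The library norm on 'rV[R]_m is the sup norm; it induces the same topology,
   but the diameter, the neighbourhoods and the Hoelder conditions below need
   the Euclidean one. *)
Definition enorm (R : realType) (m : nat) (x : 'rV[R]_m) : R :=
  Num.sqrt (\sum_(j < m) x ord0 j ^+ 2).

Definition ediam (R : realType) (m : nat) (A : set 'rV[R]_m) : \bar R :=
  ereal_sup [set (enorm (x.1 - x.2))%:E | x in A `*` A].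

Definition affine_fun (R : realType) (m : nat) (f : 'rV[R]_m -> R) : Prop :=
  exists (L : {linear 'rV[R]_m -> R^o}) (b : R), forall x, f x = L x + b.

Definition symdiff (T : Type) (A B : set T) : set T := (A `\` B) `|` (B `\` A).

Definition cvg_in_prob (dd : measure_display) (T : measurableType dd)
    (R : realType) (P : {measure set T -> \bar R})
    (f : nat -> T -> R) (g : T -> R) : Prop :=
  forall e : R, 0 < e ->
    P [set z | e < `|f k z - g z|] @[k --> \oo] --> 0%E.

(* Pieces may be empty, unlike with the library's [partition]. *)
Definition partition_of_setT (T I : Type) (B : I -> set T) : Prop :=
  \bigcup_i B i = [set: T] /\ trivIset [set: I] B.

Section empirical_process.
Context (dd : measure_display) (T : measurableType dd) (R : realType).

Definition positive_envelope (F : set (T -> R)) (C : T -> R) : Prop :=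
  [/\ forall h, F h -> measurable_fun setT h,
      measurable_fun setT C,
      forall z, 0 < C z
    & forall h, F h -> forall z, `|h z| <= C z].

Definition L2norm (Q : probability T R) (f : T -> R) : \bar R :=
  'N[Q]_2%:E[EFin \o f]%E.

Definition finite_support (Q : probability T R) : Prop :=
  exists A : set T, [/\ finite_set A, measurable A & Q A = 1%E].

Definition covered_by (Q : probability T R) (F : set (T -> R))
    (eta : \bar R) (n : nat) : Prop :=
  exists c : 'I_n -> T -> R, (forall k, F (c k)) /\
    forall h, F h -> exists k, (L2norm Q (h \- c k)%R <= eta)%E.

(* The infimum is +oo when there is no finite cover. *)
Definition covering_number (Q : probability T R) (F : set (T -> R))
    (eta : \bar R) : \bar R :=
  ereal_inf [set n%:R%:E | n in covered_by Q F eta].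

Definition entropy_integral (F : set (T -> R)) (C : T -> R) (delta : R)
    : \bar R :=
  (\int[lebesgue_measure]_(e in `]0%R, delta]%classic)
     ereal_sup
       [set sqrte (lne (2%:R%:E * covering_number Q F (e%:E * L2norm Q C)))
          | Q in finite_support])%E.

End empirical_process.

Section parametric_class.
Context (R : realType) (m : nat) (T : Type).
Variables (Theta : set 'rV[R]_m) (thstar : 'rV[R]_m) (delta : R).

Definition nbh : set 'rV[R]_m :=
  [set th | Theta th /\ enorm (th - thstar) <= delta].

Definition increment_class (G : 'rV[R]_m -> T -> R) : set (T -> R) :=
  [set (fun z => G th z - G thstar z) | th in nbh].

Definition symdiff_union (B : 'rV[R]_m -> set T) : set T :=
  \bigcup_(th in nbh) symdiff (B th) (B thstar).

End parametric_class.

Definition piece (R : realType) (m : nat) (T : Type) (s : nat)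
    (I : 'I_s -> set R) (a : 'I_s -> R) (Lam : 'I_s -> 'rV[R]_m -> T -> R)
    (th : 'rV[R]_m) : set T :=
  \bigcap_(l in [set: 'I_s]) [set z | I l (Lam l th z + a l)].

Definition xi (R : realType) (T : Type) (r : nat) (beta : 'I_r -> R)
    (C : 'I_r -> T -> R) (Gstar : 'I_r -> T -> R) (Bhat : 'I_r -> set T)
    (delta : R) (z : T) : R :=
  \sum_(i < r) (2 * delta `^ beta i * C i z
                + `|Gstar i z| * \1_(Bhat i) z
                + Num.min delta 1 ^+ 2).

Definition d_coef (m r : nat) (s : 'I_r -> nat) : nat :=
  ((m + 2) * \sum_(i < r) s i)%N.

Definition c_coef (R : realType) (m r : nat) (beta : 'I_r -> R) (e : R) : R :=
  2 * r%:R * m%:R * ln 3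
  + m%:R * ln (8 * (r%:R + 1) / e) * \sum_(i < r) (beta i)^-1.

(* Main.v *)
Require Import Defs.
From mathcomp Require Import ring lra measurable_realfun.

Set Implicit Arguments.
Unset Strict Implicit.
Unset Printing Implicit Defensive.

(** For a finitely supported Q, the increments are covered by a product of two
    finite partitions of the parameter neighbourhood. The first is a Euclidean grid
    fine enough for all Hoelder exponents at once, with exponentially many (in m)
    cells. The second clusters the parameters by the sign patterns of the affine
    functions [Lam i l _ z + a i l] on the points (i, l, z): these patterns have
    VC dimension at most m, so a maximal separated family of them is small, by
    random sampling and Pajor's inequality. Hence ln (2 N(eta)) <= A - B ln eta
    uniformly in Q; with c the constant of the theorem divided by the upper end e,
    sqrt y <= (y + c ^ 2) / (2 c) makes the integral over ]0, e] explicit, and the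
    claim reduces to A + B (1 - ln e) <= c ^ 2. *)

(** * Shattered sets and Pajor's inequality *)

Section Pajor.
Import mathcomp.boot.fintype mathcomp.boot.finset.
Variable X : finType.
Implicit Types (F : {set {set X}}) (S A B : {set X}).

Definition shatters F S :=
  [forall A : {set X}, (A \subset S) ==> [exists B in F, (B :&: S) == A]].

Lemma shattersP F S :
  reflect (forall A, A \subset S -> exists2 B, B \in F & (B :&: S) = A)
          (shatters F S).
Proof.
apply: (iffP forallP) => [h A AS|h A].
  by move: (h A) => /implyP/(_ AS)/exists_inP[B BF /eqP]; exists B.
by apply/implyP => /h[B BF e]; apply/exists_inP; exists B => //; apply/eqP.
Qed.

Lemma shatters_sub F F' S : F \subset F' -> shatters F S -> shatters F' S.
Proof.
move=> sFF /shattersP h; apply/shattersP => A /h[B BF e].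
by exists B => //; apply: (subsetP sFF).
Qed.

(** If x lay in S, the full trace on S would force b to be true and the empty trace would force it
    to be false. *)
Lemma shatters_notin F S x b :
  (forall B, B \in F -> (x \in B) = b) -> shatters F S -> x \notin S.
Proof.
move=> hF /shattersP h; apply/negP => xS.
have [B0 B0F e0] := h set0 (sub0set _).
have [B1 B1F e1] := h S (subxx _).
have : x \in (B1 :&: S) by rewrite e1.
rewrite inE xS andbT (hF _ B1F) => bT.
have : x \in (B0 :&: S) by rewrite inE xS (hF _ B0F) bT.
by rewrite e0 inE.
Qed.

(** Strong induction on the size of F, which is split by membership of a point x into two nonempty
    halves. A set S shattered by both halves is counted twice by the induction hypotheses; the
    second count is spent on [x |: S], which F shatters too, though neither half does. *)
Lemma pajor F : #|F| <= #|[set S | shatters F S]|.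
Proof.
have [n] := ubnP #|F|; elim: n F => // n IH F; rewrite ltnS => Fn.
have [F1|F1] := leqP #|F| 1.
  case: (posnP #|F|) => [->//|F0].
  apply: (leq_trans F1); apply/card_gt0P; exists set0; rewrite inE.
  apply/shattersP => A; rewrite subset0 => /eqP ->.
  by move/card_gt0P: F0 => [B BF]; exists B => //; rewrite setI0.
have [A AF [B BF AB]] : exists2 A, A \in F & exists2 B, B \in F & A != B.
  by move/card_gt1P: F1 => [A [B [? ? ?]]]; exists A => //; exists B.
have [x xAB] : exists x, (x \in A) != (x \in B).
  apply/existsP; apply: contraNT AB; rewrite negb_exists => /forallP h.
  by apply/eqP/setP => x; apply/eqP; move: (h x); rewrite negbK.
pose F_ (b : bool) := [set C in F | (x \in C) == b].
have F_sub b : F_ b \subset F by apply/subsetP => C; rewrite inE => /andP[].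
have F_x b C : C \in F_ b -> (x \in C) = b by rewrite inE => /andP[_ /eqP].
have cF : #|F| = #|F_ true| + #|F_ false|.
  rewrite -(cardsID [set C : {set X} | x \in C] F); congr (_ + _); apply: eq_card => C.
    by rewrite !inE eqb_id.
  by rewrite !inE andbC eqbF_neg.
have F_n0 b : 0 < #|F_ b|.
  apply/card_gt0P; have [xA|xA] := eqVneq (x \in A) b.
    by exists A; rewrite inE AF xA eqxx.
  exists B; rewrite inE BF /=.
  by move: xAB xA; case: (x \in A); case: (x \in B); case: (b).
have F_lt b : #|F_ b| < n.
  apply: leq_trans Fn; rewrite cF.
  by case: b; [rewrite -[ltnLHS]addn0 ltn_add2l|rewrite -[ltnLHS]add0n ltn_add2r].
pose Sh b := [set S | shatters (F_ b) S].
have ShN b S : S \in Sh b -> x \notin S.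
  by rewrite inE; apply: shatters_notin (F_x b).
rewrite cF; apply: leq_trans (leq_add (IH _ (F_lt true)) (IH _ (F_lt false))) _.
rewrite -/(Sh true) -/(Sh false) -cardsUI.
(* Sets shattered by a half avoid x, so adding x is injective on them and yields sets outside the
   union. *)
have -> : #|Sh true :&: Sh false| =
          #|[set (x |: S) | S in (Sh true :&: Sh false)]|.
  rewrite card_in_imset // => S S' /setIP[/ShN xS _] /setIP[/ShN xS' _] e.
  by rewrite -(setU1K xS) e setU1K.
have disj : (Sh true :|: Sh false) :&:
    [set x |: S | S in Sh true :&: Sh false] = set0.
  apply/setP => S; rewrite !inE; apply/negP => /andP[h /imsetP[S' _ e]].
  have : x \in S by rewrite e setU11.
  by apply/negP; move: h => /orP[h|h];
    [apply: (ShN true)|apply: (ShN false)]; rewrite inE.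
rewrite -cardsUI disj cards0 addn0.
apply: subset_leq_card; apply/subsetP => S /setUP[/setUP[]|].
  - by rewrite !inE; apply: shatters_sub.
  - by rewrite !inE; apply: shatters_sub.
  (* Whether x belongs to C decides the half in which a member with trace [C :\ x] on S' is
     sought. *)
  move/imsetP => [S' /setIP[S1 S0] ->]; rewrite inE; apply/shattersP => C CS.
  have xS' := ShN _ _ S1.
  have Sb : S' \in Sh (x \in C) by case: (x \in C).
  move: Sb; rewrite inE => /shattersP /(_ (C :\ x)).
  case=> [|D DF e].
    by rewrite subDset.
  exists D; first exact: (subsetP (F_sub _)) DF.
  have xD := F_x _ _ DF.
  apply/setP => y; rewrite !inE; have [->|yx] := eqVneq y x.
    by rewrite xD andbT.
  by move/setP/(_ y): e; rewrite !inE yx.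
Qed.

End Pajor.

(** * Sign patterns of affine functions *)

Local Open Scope classical_set_scope.
Local Open Scope ring_scope.

(* A linear dependency v between the linear parts makes the v-combination of the
   affine functions constant; the sign patterns of -v and v force this constant to
   be <= 0 and >= 0, so in both patterns every term vanishes. *)
Lemma halfspaces_shattered_le (R : realType) (m n : nat)
    (f : 'I_n -> 'rV[R]_m -> R) (I : 'I_n -> set R) :
  (forall j, affine_fun (f j)) ->
  (forall j, I j = `]0, +oo[%classic \/ I j = `[0, +oo[%classic) ->
  (forall A : {set 'I_n}, exists th, forall j, I j (f j th) <-> j \in A) ->
  (n <= m)%N.
Proof.
move=> faff hI sh; rewrite leqNgt; apply/negP => mn.
have I_ge0 j x : I j x -> 0 <= x.
  by case: (hI j) => -> /=; rewrite in_itv /= andbT // => /ltW.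
have I_le0 j x : ~ I j x -> x <= 0.
  case: (hI j) => -> /=; rewrite in_itv /= andbT => /negP; first by rewrite -leNgt.
  by rewrite -ltNge => /ltW.
have /choice[L /choice[b Lb]] := faff.
pose U := \matrix_(j < n, k < m) L j (delta_mx 0 k).
have UE j x : L j x = \sum_k x 0 k * U j k.
  rewrite {1}(row_sum_delta x) linear_sum; apply: eq_bigr => k _.
  by rewrite linearZ mxE.
have : kermx U != 0.
  rewrite kermx_eq0 /row_free; apply/negP => /eqP e.
  by move: mn; rewrite -e ltnNge rank_leq_col.
move=> /rowV0Pn[v /sub_kermxP vU v0].
have vf th : \sum_j v 0 j * f j th = \sum_j v 0 j * b j.
  under eq_bigr do rewrite Lb mulrDr UE.
  rewrite big_split /= [X in X + _](_ : _ = 0) ?add0r //.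
  under eq_bigr do rewrite mulr_sumr.
  rewrite exchange_big /= big1// => k _.
  under eq_bigr do rewrite mulrCA.
  rewrite -mulr_sumr; move/rowP/(_ k): vU; rewrite !mxE => ->.
  by rewrite mulr0.
have [t1 h1] := sh [set j | v 0 j < 0]%SET.
have [t2 h2] := sh [set j | v 0 j > 0]%SET.
have p1 j : 0 <= - (v 0 j * f j t1).
  rewrite -mulrN; have [vj|vj] := ltP (v 0 j) 0.
    rewrite mulrN -mulNr mulr_ge0// ?oppr_ge0 ?(ltW vj)//.
    by apply/(I_ge0 j)/h1; rewrite inE.
  rewrite mulr_ge0// oppr_ge0; apply: (I_le0 j) => /h1.
  by rewrite inE ltNge vj.
have p2 j : 0 <= v 0 j * f j t2.
  have [vj|vj] := ltP 0 (v 0 j).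
    by rewrite mulr_ge0// ?(ltW vj)//; apply/(I_ge0 j)/h2; rewrite inE.
  rewrite -mulrNN mulr_ge0// oppr_ge0//; apply: (I_le0 j) => /h2.
  by rewrite inE ltNge vj.
have c0 : \sum_j v 0 j * b j = 0.
  apply/eqP; rewrite eq_le -{1}(vf t1) -(vf t2) sumr_ge0// andbT.
  by rewrite -oppr_ge0 -sumrN sumr_ge0.
have z1 j : v 0 j * f j t1 = 0.
  have /eqP := vf t1; rewrite c0 -oppr_eq0 -sumrN psumr_eq0// => /allP/(_ j).
  by rewrite mem_index_enum oppr_eq0 => /(_ isT) /eqP.
have z2 j : v 0 j * f j t2 = 0.
  have /eqP := vf t2; rewrite c0 psumr_eq0// => /allP/(_ j).
  by rewrite mem_index_enum => /(_ isT) /eqP.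
have /rV0Pn[j vj] := v0.
have f1 : f j t1 = 0 by have /eqP := z1 j; rewrite mulf_eq0 (negbTE vj) => /eqP.
have f2 : f j t2 = 0 by have /eqP := z2 j; rewrite mulf_eq0 (negbTE vj) => /eqP.
(* Whether 0 lies in [I j] would now be equivalent both to v_j < 0 and to v_j > 0, while v_j is
   nonzero. *)
have := h1 j; have := h2 j; rewrite f1 f2 !inE.
case: (ltgtP (v 0 j) 0) vj => // _ _ [ha hb] [hc hd].
  by have := ha (hd isT).
by have := hc (hb isT).
Qed.

(** * Packing bounds for set families of bounded VC dimension *)

Fact sample_exponent (R : realType) (L k : R) :
  k != 0 -> (2 * L / k + 1) * (k / 4) = L / 2 + k / 4.
Proof. by move=> k0; field. Qed.

Fact absorb_half (R : realType) (u v k : R) :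
  u <= v + (u / 2 + k / 4) -> u <= 2 * v + k / 2.
Proof. lra. Qed.

Section Packing.
Import mathcomp.boot.fintype mathcomp.boot.finset.
Context (R : realType).

(** Exponential weights: since t <= 1, a set J of at most m elements has weight t ^ #|J| >= t ^ m,
    and the weights of all subsets add up to (1 + t) ^ n. *)
Lemma card_small_subsets (n m : nat) (t : R) : 0 < t <= 1 ->
  #|[set J : {set 'I_n} | (#|J| <= m)%N]%SET|%:R <= t^-1 ^+ m * (1 + t) ^+ n.
Proof.
move=> /andP[t0 t1].
have -> : (1 + t) ^+ n = \sum_(J : {set 'I_n}) t ^+ #|J|.
  have -> : (1 + t) ^+ n = \prod_(i < n) (t + 1).
    by rewrite prodr_const card_ord addrC.
  rewrite bigA_distr; apply: eq_bigr => J _.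
  by rewrite -big_mkcond /= prodr_const.
rewrite mulr_sumr -sum1_card natr_sum big_mkcond /=.
apply: ler_sum => J _; rewrite inE; case: ifP => [Jm|_]; last first.
  by rewrite mulr_ge0// exprn_ge0// ?invr_ge0 ltW.
rewrite exprVn mulrC ler_pdivlMr ?exprn_gt0// mul1r.
by rewrite ler_wiXn2l// ltW.
Qed.

Variables (X : finType) (w : X -> R) (Fam : {set {set X}}) (k : R).
Hypothesis w_ge0 : forall x, 0 <= w x.
Hypothesis w_sum1 : \sum_x w x = 1.
Hypothesis k01 : 0 < k <= 1.
Hypothesis Fam_gt0 : (0 < #|Fam|)%N.
Hypothesis sep : forall A B, A \in Fam -> B \in Fam -> A != B ->
  k <= \sum_(x | (x \in A) != (x \in B)) w x.

(* Union bound over the pairs of Fam for n independent samples drawn from w. *)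
Lemma separating_sample (n : nat) :
  #|Fam|%:R ^+ 2 * (1 - k) ^+ n <= 1 ->
  exists f : 'I_n -> X, {in Fam &, injective (fun A : {set X} => [set i | f i \in A])}.
Proof.
move=> small; apply: contrapT => nsep.
pose pairs := [set p | [&& p.1 \in Fam, p.2 \in Fam & p.1 != p.2]].
(* The product of [c p] along a sample is the probability of the sample if it fails to separate p,
   and 0 otherwise. *)
pose c (p : {set X} * {set X}) x : R := w x * ((x \in p.1) == (x \in p.2))%:R.
have c0 p x : 0 <= c p x by rewrite mulr_ge0.
have le_pairs : 1 <= \sum_(p in pairs) (1 - k) ^+ n.
  have {1}-> : 1 = \sum_(f : {ffun 'I_n -> X}) \prod_i w (f i).
    by rewrite -(bigA_distr_bigA (fun _ x => w x)) /= big1// => i _.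
  apply: (@le_trans _ _
      (\sum_(f : {ffun 'I_n -> X}) \sum_(p in pairs) \prod_i c p (f i))).
    apply: ler_sum => f _.
    have [p pP fp] : exists2 p, p \in pairs &
        forall i, (f i \in p.1) = (f i \in p.2).
      apply: contrapT => h; apply: nsep; exists f => A B AF BF /setP e.
      apply/eqP; apply: contrapT => /negP AB; apply: h.
      exists (A, B); first by rewrite inE AF BF AB.
      by move=> i; have := e i; rewrite !inE.
    rewrite (bigD1 p)//= [X in _ <= X + _](_ : _ = \prod_i w (f i)).
      by rewrite lerDl sumr_ge0// => q _; rewrite prodr_ge0.
    by apply: eq_bigr => i _; rewrite /c fp eqxx mulr1.
  rewrite exchange_big /=; apply: ler_sum => p; rewrite inE => /and3P[p1 p2 p12].
  rewrite -(bigA_distr_bigA (fun _ x => c p x)) /= prodr_const card_ord.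
  have /andP[_ k1] := k01.
  apply: lerXn2r; rewrite ?nnegrE ?subr_ge0 ?sumr_ge0//.
  rewrite lerBrDr -w_sum1 [leRHS](bigID (fun x => (x \in p.1) == (x \in p.2)) xpredT) /=.
  apply: lerD; last exact: sep.
  rewrite big_mkcond /= [leRHS]big_mkcond /=; apply: ler_sum => x _.
  by rewrite /c; case: eqP; rewrite ?mulr1 ?mulr0.
rewrite sumr_const -mulr_natl in le_pairs.
(* Leaving out the diagonal gives the strict inequality that contradicts [small]. *)
have lt_pairs : (#|pairs| < #|Fam| ^ 2)%N.
  have /card_gt0P[A AF] := Fam_gt0.
  rewrite -mulnn -cardsX; apply: proper_card; apply/properP; split.
    by apply/subsetP => p; rewrite !inE => /and3P[-> ->].
  by exists (A, A); rewrite !inE ?AF ?eqxx.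
have q0 : 0 <= (1 - k) ^+ n.
  by rewrite exprn_ge0// subr_ge0; case/andP: k01.
(* If (1 - k) ^ n = 0, strictness is lost under multiplication, but [le_pairs] then already reads 1
   <= 0. *)
move: q0; rewrite le_eqVlt => /predU1P[q0|q0].
  by move: le_pairs; rewrite -q0 mulr0 ler10.
have : #|pairs|%:R * (1 - k) ^+ n < #|Fam|%:R ^+ 2 * (1 - k) ^+ n.
  by rewrite ltr_pM2r// -natrX ltr_nat.
by move=> h; have := le_lt_trans le_pairs (lt_le_trans h small); rewrite ltxx.
Qed.

Variable m : nat.
Hypothesis vc : forall n (f : 'I_n -> X),
  (forall A : {set 'I_n}, exists2 B, B \in Fam & forall j, (f j \in B) = (j \in A)) ->
  (n <= m)%N.

(** Let M be the size of [Fam]. About 2 ln M / k sample points separate the family, so it has M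
    traces on the sample. By Pajor's inequality these shatter at least M index sets, each of size at
    most m by [vc], and [card_small_subsets] bounds their number. As the sample size involves ln M,
    so does the bound, but with a factor 1/2 that can be absorbed. *)
Lemma ln_card_separated :
  ln #|Fam|%:R <= 2 * m%:R * ln (4 / k) + k / 2 :> R.
Proof.
have /andP[k0 k1] := k01.
set M : R := #|Fam|%:R.
have M1 : 1 <= M by rewrite ler1n.
have M0 : 0 < M by apply: lt_le_trans M1.
have lnM0 : 0 <= ln M by apply: ln_ge0.
(* Large enough for M ^ 2 * exp (- k n) <= 1, the union bound of [separating_sample]. *)
pose n := (Num.truncn (2 * ln M / k)).+1.
have nge : 2 * ln M / k <= n%:R by apply/ltW/truncnS_gt.
have nle : n%:R <= 2 * ln M / k + 1.
  rewrite /n -natr1 lerD2r truncn_le//.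
  by rewrite divr_ge0 ?mulr_ge0// ltW.
have [f finj] : exists f : 'I_n -> X,
    {in Fam &, injective (fun A : {set X} => [set i | f i \in A])}.
  apply: separating_sample; rewrite -/M.
  have le1k : 1 - k <= expR (- k) by have := expR_ge1Dx (- k).
  have -> : M ^+ 2 = expR (2 * ln M).
    by rewrite expRM_natl lnK// posrE.
  apply: (@le_trans _ _ (expR (2 * ln M) * expR (- k) ^+ n)).
    rewrite ler_wpM2l ?expR_ge0//; apply: lerXn2r; rewrite ?nnegrE ?expR_ge0//.
    by rewrite subr_ge0.
  rewrite -expRM_natl -expRD -[leRHS]expR0 ler_expR mulrN subr_le0.
  by move: nge; rewrite ler_pdivrMr.
pose F' := [set [set i | f i \in A] | A : {set X} in Fam].
have cF' : #|F'| = #|Fam| by rewrite card_in_imset.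
(* With this t, n * t is at most ln M / 2 + k / 4. *)
pose t := k / 4.
have t01 : 0 < t <= 1 by rewrite /t; lra.
have t0 : 0 < t by case/andP: t01.
have : M <= t^-1 ^+ m * (1 + t) ^+ n.
  apply: le_trans (card_small_subsets n m t01).
  rewrite /M ler_nat -cF'; apply: leq_trans (pajor F') _.
  apply: subset_leq_card; apply/subsetP => J; rewrite !inE => /shattersP sh.
  apply: (vc (f := fun i : 'I_#|J| => f (enum_val i))) => A.
  have [|B /imsetP[B' B'F ->] e] := sh [set enum_val i | i in A].
    by apply/subsetP => j /imsetP[i _ ->]; exact: enum_valP.
  exists B' => // j; move/setP/(_ (enum_val j)): e.
  rewrite !inE enum_valP andbT => ->.
  by rewrite mem_imset//; exact: enum_val_inj.
have ->: t^-1 = 4 / k by rewrite /t invf_div.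
move=> MB; have h1t : 0 < 1 + t by apply: addr_gt0.
have k4 : 0 < 4 / k by rewrite divr_gt0.
have : ln M <= m%:R * ln (4 / k) + n%:R * ln (1 + t).
  apply: (@le_trans _ _ (ln ((4 / k) ^+ m * (1 + t) ^+ n))).
    by rewrite ler_ln ?posrE// mulr_gt0// exprn_gt0.
  by rewrite lnM ?posrE ?exprn_gt0// !lnXn// !mulr_natl.
have : ln (1 + t) <= t.
  by rewrite -ler_expR lnK ?posrE// expR_ge1Dx.
move=> lt lM.
have : n%:R * ln (1 + t) <= ln M / 2 + k / 4.
  apply: (@le_trans _ _ (n%:R * t)); first by rewrite ler_wpM2l.
  apply: (@le_trans _ _ ((2 * ln M / k + 1) * t)).
    by rewrite ler_wpM2r// ltW.
  by rewrite /t sample_exponent// gt_eqF.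
move=> lnn; have : ln M <= m%:R * ln (4 / k) + (ln M / 2 + k / 4).
  by apply: le_trans lM _; rewrite lerD2l.
by rewrite -mulrA; exact: absorb_half.
Qed.

End Packing.

(** * Clustering parameters by their patterns *)

Section PatternClasses.
Import mathcomp.boot.fintype mathcomp.boot.finset.
Context (R : realType).

(** A maximal k-separated family of realised patterns is also a k-net. Sending each parameter to a
    member within k of its pattern leaves any two parameters of one class within 2 k, and
    [ln_card_separated] bounds the number of classes. *)
Lemma pattern_classes (X : finType) (w : X -> R) (k : R) (m : nat)
    (T : Type) (U : set T) (pat : T -> {set X}) :
  (forall x, 0 <= w x) -> \sum_x w x = 1 -> 0 < k <= 1 -> U !=set0 ->
  (forall n (f : 'I_n -> X),
     (forall A : {set 'I_n},
        exists2 t, U t & forall j, (f j \in pat t) = (j \in A)) -> (n <= m)%N) ->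
  exists (M : nat) (c : T -> 'I_M),
    [/\ (0 < M)%N, ln M%:R <= 2 * m%:R * ln (4 / k) + k / 2 &
      forall t u, U t -> U u -> c t = c u ->
        \sum_(x | (x \in pat t) != (x \in pat u)) w x <= 2 * k].
Proof.
move=> w0 w1 k01 [t0 Ut0] vc.
pose dist (A B : {set X}) := \sum_(x | (x \in A) != (x \in B)) w x.
have distC A B : dist A B = dist B A by apply: eq_bigl => x; rewrite eq_sym.
have distD A B C : dist A C <= dist A B + dist B C.
  rewrite /dist big_mkcond [X in _ <= X + _]big_mkcond [X in _ <= _ + X]big_mkcond /=.
  rewrite -big_split /=; apply: ler_sum => x _.
  have := w0 x; move: (w x) => W W0.
  by case: (x \in A); case: (x \in B); case: (x \in C) => /=; lra.
pose P (F : {set {set X}}) :=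
  (F \subset [set A | `[< exists2 t, U t & pat t = A >]]) &&
  [forall A in F, [forall B in F, (A != B) ==> (k <= dist A B)]].
have P0 : P [set pat t0].
  apply/andP; split.
    by apply/subsetP => A /set1P ->; rewrite inE; apply/asboolP; exists t0.
  apply/forall_inP => A /set1P ->; apply/forall_inP => B /set1P ->.
  by rewrite eqxx.
have [F /maxsetP[/andP[/subsetP FU /forall_inP Fsep] Fmax] F0] := maxset_exists P0.
have Fpat0 : pat t0 \in F by move/subsetP: F0; apply; rewrite inE.
have near t : exists A, A \in F /\ (U t -> dist (pat t) A <= k).
  (* Outside U an arbitrary member serves, so that the class map is total. *)
  have [Ut|nUt] := pselect (U t); last by exists (pat t0); split.
  apply: contrapT => far.
  have farF A : A \in F -> k <= dist (pat t) A.
    move=> AF; rewrite leNgt; apply/negP => lt; apply: far.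
    by exists A; split => // _; apply: ltW.
  have : pat t |: F = F.
    apply: Fmax; last exact: subsetUr.
    apply/andP; split.
      apply/subsetP => A /setU1P[->|/FU//].
      by rewrite inE; apply/asboolP; exists t.
    apply/forall_inP => A /setU1P[->|AF]; apply/forall_inP => B /setU1P[->|BF].
    - by rewrite eqxx.
    - by apply/implyP => _; exact: farF.
    - by apply/implyP => _; rewrite distC; exact: farF.
    - by move/forall_inP: (Fsep _ AF); apply.
  move=> e; apply: far; exists (pat t); split; first by rewrite -e setU11.
  move=> _; rewrite /dist big1; first by case/andP: k01 => /ltW.
  by move=> x; rewrite eqxx.
have [g /all_and2[gF gk]] := choice near.
exists #|F|, (fun t => enum_rank_in Fpat0 (g t)); split.
- by apply/card_gt0P; exists (pat t0).
- apply: (ln_card_separated w0 w1 k01) => //.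
  + by apply/card_gt0P; exists (pat t0).
  + by move=> A B AF BF AB; move/forall_inP: (Fsep _ AF) => /(_ _ BF)/implyP/(_ AB).
  + move=> n f h; apply: (vc n f) => A; have [B BF BA] := h A.
    move: (FU _ BF); rewrite inE => /asboolP[t Ut tB].
    by exists t => // j; rewrite tB.
- move=> t u Ut Uu e.
  have gtu : g t = g u.
    by rewrite -(enum_rankK_in Fpat0 (gF t)) -(enum_rankK_in Fpat0 (gF u)) e.
  rewrite -/(dist _ _); apply: le_trans (distD _ (g t) _) _.
  by rewrite mulr2n mulrDl mul1r lerD ?gk// distC gtu gk.
Qed.

End PatternClasses.

(** * Grid cells meeting a Euclidean ball *)

Section EuclideanGrid.
Context (R : realType).

(** Exponential weights again: q to the l1-norm is at least q ^ N on the ball, and the total weight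
    factorises over the coordinates into two truncated geometric series each, one per sign. *)
Lemma card_ball_l1 (m N : nat) (q : R) : 0 < q < 1 ->
  #|[set f : {ffun 'I_m -> bool * 'I_N.+1} | (\sum_j (f j).2 <= N)%N]%SET|%:R
    <= q^-1 ^+ N * (2 / (1 - q)) ^+ m.
Proof.
move=> /andP[q0 q1]; have q1' : 0 < 1 - q by rewrite subr_gt0.
apply: (@le_trans _ _ (q^-1 ^+ N *
    \sum_(f : {ffun 'I_m -> bool * 'I_N.+1}) \prod_j q ^+ (f j).2)).
  rewrite mulr_sumr -sum1_card natr_sum big_mkcond /=; apply: ler_sum => f _.
  rewrite inE -expr_sum; case: ifP => [fN|_]; last first.
    by rewrite mulr_ge0// exprn_ge0// ?invr_ge0 ltW.
  rewrite exprVn mulrC ler_pdivlMr ?exprn_gt0// mul1r.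
  by rewrite ler_wiXn2l// ltW.
rewrite ler_wpM2l ?exprn_ge0 ?invr_ge0 ?(ltW q0)//.
rewrite -(bigA_distr_bigA (fun _ (p : bool * 'I_N.+1) => q ^+ p.2)) /=.
rewrite prodr_const card_ord; apply: lerXn2r; rewrite ?nnegrE.
- by apply: sumr_ge0 => p _; rewrite exprn_ge0// ltW.
- by rewrite divr_ge0// ltW.
rewrite -(pair_bigA _ (fun (_ : bool) (k : 'I_N.+1) => q ^+ k)) /=.
rewrite sumr_const card_bool -[leLHS]mulr_natl; apply: ler_wpM2l => //.
rewrite -[leRHS]mul1r ler_pdivlMr// mulrC.
have -> : (1 - q) * \sum_(k < N.+1) q ^+ k = 1 - q ^+ N.+1.
  by rewrite -opprB mulNr -subrX1 opprB.
by rewrite gerBl exprn_ge0// ltW.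
Qed.

End EuclideanGrid.

Section EuclideanCells.
Context (R : realType).

Lemma enorm_leP (m : nat) (x : 'rV[R]_m) (d : R) : 0 <= d ->
  (enorm x <= d) = (\sum_j x ord0 j ^+ 2 <= d ^+ 2).
Proof.
move=> d0; have s0 : 0 <= \sum_j x ord0 j ^+ 2.
  by apply: sumr_ge0 => j _; exact: sqr_ge0.
by rewrite -{1}(sqr_sqrtr s0) ler_sqr ?nnegrE ?sqrtr_ge0.
Qed.

(** The sign is recorded separately because cells are numbered by absolute values, which would
    identify x with - x. *)
Fact same_cell_dist (h x y : R) : 0 < h -> (0 <= x) = (0 <= y) ->
  Num.truncn (`|x| / h) = Num.truncn (`|y| / h) -> `|x - y| <= h.
Proof.
move=> h0 sxy.
have /truncn_itv/andP[] : 0 <= `|x| / h by rewrite divr_ge0// ltW.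
have /truncn_itv/andP[] : 0 <= `|y| / h by rewrite divr_ge0// ltW.
move=> + + + + e; rewrite e.
rewrite !ler_pdivlMr// !ltr_pdivrMr//.
have -> : (Num.truncn (`|y| / h)).+1%:R = (Num.truncn (`|y| / h))%:R + 1 :> R.
  by rewrite natr1.
move: (_%:R) => k; rewrite mulrDl mul1r ler_norml.
have [x0|x0] := leP 0 x; move: sxy.
  by rewrite x0 => /esym y0; rewrite (ger0_norm x0) (ger0_norm y0) => *; lra.
rewrite leNgt x0 /= => /esym/negbT; rewrite -ltNge => y0.
by rewrite (ltr0_norm x0) (ltr0_norm y0) => *; lra.
Qed.

Fact cell_count_arith (u a b c d : R) : a <= u -> b <= u ->
  a + (c + b + d) <= c + (u + u) + d.
Proof. lra. Qed.

(* The cells have Euclidean diameter at most d / K; those that meet the ball have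
   integer coordinates of l1-norm at most m K, which is what keeps the number of
   cells exponential in m. *)
Lemma euclidean_cells (m : nat) (d K : R) : (0 < m)%N -> 0 < d -> 1 <= K ->
  exists (M : nat) (c : 'rV[R]_m -> 'I_M),
    [/\ (0 < M)%N, ln M%:R <= m%:R * (ln 2 + 2 + ln K) &
      forall x y, enorm x <= d -> enorm y <= d -> c x = c y ->
        enorm (x - y) <= d / K].
Proof.
move=> m0 d0 K1; have K0 : 0 < K by apply: lt_le_trans K1.
have mR0 : 0 < m%:R :> R by rewrite ltr0n.
pose s : R := Num.sqrt m%:R.
have s0 : 0 < s by rewrite sqrtr_gt0.
have ss : s ^+ 2 = m%:R by rewrite sqr_sqrtr// ltW.
(* A cube of side h has diagonal sqrt m * h = d / K. *)
pose h := d / s / K.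
have h0 : 0 < h by rewrite !divr_gt0.
pose N := Num.truncn (m%:R * K).
have mK0 : 0 <= m%:R * K by rewrite mulr_ge0// ltW.
(* Then 1 / q = 1 + 1 / K, so q ^ (- N) is at most exp m as N <= m K, while 2 / (1 - q) = 2 (1 + 1 /
   K) K. *)
pose q := K / (1 + K).
have q01 : 0 < q < 1.
  by rewrite /q divr_gt0 ?addr_gt0//= ltr_pdivrMr ?addr_gt0// mul1r ltrDr.
(* [inord] may return its default value outside the ball; inside it, [coord_le] makes it exact. *)
pose cell (x : 'rV[R]_m) : {ffun 'I_m -> bool * 'I_N.+1} :=
  [ffun j => (0 <= x ord0 j, inord (Num.truncn (`|x ord0 j| / h)))].
pose B := [set f : {ffun 'I_m -> bool * 'I_N.+1} | (\sum_j (f j).2 <= N)%N]%SET.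
have sum_le (x : 'rV[R]_m) : enorm x <= d ->
    (\sum_j Num.truncn (`|x ord0 j| / h)%R <= N)%N.
  rewrite enorm_leP ?(ltW d0)// => xd.
  rewrite /N truncn_ge_nat// natr_sum.
  have c0 : 0 < d / s by rewrite divr_gt0.
  (* The arithmetic-geometric mean inequality, balanced so that the sum over j is at most (m + m) *
     (K / 2) = m K. *)
  have amgm j : `|x ord0 j| / h <=
      (x ord0 j ^+ 2 / d ^+ 2 * m%:R + 1) * (K / 2).
    rewrite ler_pdivrMr// /h -(real_normK (num_real (x ord0 j))).
    move: `|_| => u; rewrite -ss -subr_ge0.
    have -> : (u ^+ 2 / d ^+ 2 * s ^+ 2 + 1) * (K / 2) * (d / s / K) - u =
      (u * s - d) ^+ 2 / (2 * d * s).
      by field; rewrite !gt_eqF.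
    by rewrite divr_ge0 ?sqr_ge0// !mulr_ge0// ltW.
  apply: (@le_trans _ _ (\sum_j (x ord0 j ^+ 2 / d ^+ 2 * m%:R + 1) * (K / 2))).
    apply: ler_sum => j _; apply: le_trans (amgm j).
    by rewrite truncn_le divr_ge0// ltW.
  rewrite -mulr_suml.
  have -> : \sum_(j < m) (x ord0 j ^+ 2 / d ^+ 2 * m%:R + 1) =
      (\sum_j x ord0 j ^+ 2) / d ^+ 2 * m%:R + m%:R.
    by rewrite big_split /= -!mulr_suml sumr_const card_ord.
  have : (\sum_j x ord0 j ^+ 2) / d ^+ 2 <= 1.
    by rewrite ler_pdivrMr ?exprn_gt0// mul1r.
  move: (_ / d ^+ 2) => u u1.
  have -> : m%:R * K = (m%:R + m%:R) * (K / 2) by field.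
  apply: ler_wpM2r; first by rewrite divr_ge0// ltW.
  by rewrite lerD2r -[leRHS]mul1r ler_wpM2r.
have coord_le (x : 'rV[R]_m) j : enorm x <= d ->
    (Num.truncn (`|x ord0 j| / h) < N.+1)%N.
  by move/sum_le => xd; rewrite ltnS (leq_trans _ xd)// (bigD1 j)//= leq_addr.
have cellB x : enorm x <= d -> cell x \in B.
  move=> xd; rewrite inE; apply: leq_trans (sum_le x xd).
  by apply: leq_sum => j _; rewrite ffunE /= inordK// coord_le.
have B0 : cell 0 \in B.
  apply: cellB; rewrite enorm_leP ?(ltW d0)//.
  by rewrite big1 ?exprn_ge0 ?(ltW d0)// => j _; rewrite mxE expr0n.
exists #|B|, (fun x => enum_rank_in B0 (cell x)); split.
- by apply/card_gt0P; exists (cell 0).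
- have q0 : 0 < q by case/andP: q01.
  have q1 : 0 < 1 - q by rewrite subr_gt0; case/andP: q01.
  have cB0 : 0 < #|B|%:R :> R by rewrite ltr0n; apply/card_gt0P; exists (cell 0).
  apply: (@le_trans _ _ (ln (q^-1 ^+ N * (2 / (1 - q)) ^+ m))).
    rewrite ler_ln ?posrE ?card_ball_l1// mulr_gt0// exprn_gt0// ?invr_gt0//.
    by rewrite divr_gt0.
  have K1' : 0 < 1 + K^-1 by rewrite addr_gt0// invr_gt0.
  have -> : q^-1 = 1 + K^-1 by rewrite /q; field; rewrite !gt_eqF// addr_gt0.
  have -> : 2 / (1 - q) = 2 * (1 + K^-1) * K.
    have -> : 1 - q = (1 + K)^-1.
      by rewrite /q; field; rewrite gt_eqF// addr_gt0.
    by rewrite invrK; field; rewrite gt_eqF.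
  have pos2 : 0 < 2 * (1 + K^-1) * K by rewrite !mulr_gt0.
  rewrite lnM ?posrE ?exprn_gt0// !lnXn ?invr_gt0//.
  rewrite -[X in X + _]mulr_natl -[X in _ + X]mulr_natl.
  rewrite !lnM ?posrE// ?mulr_gt0//.
  have lnK : ln (1 + K^-1) <= K^-1.
    by apply: le_ln1Dx; apply: (@lt_trans _ _ 0); rewrite ?ltrN10// invr_gt0.
  have Ki1 : K^-1 <= 1 by rewrite invf_le1.
  have : N%:R * ln (1 + K^-1) <= m%:R.
    apply: (@le_trans _ _ (N%:R * K^-1)); first by rewrite ler_wpM2l.
    by rewrite ler_pdivrMr// truncn_le.
  move=> NK; have ml : m%:R * ln (1 + K^-1) <= m%:R.
    by rewrite -[leRHS]mulr1 ler_wpM2l// (le_trans lnK).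
  by rewrite !mulrDr !mulr1; exact: cell_count_arith.
- move=> x y xd yd e.
  have {}e : cell x = cell y.
    by rewrite -(enum_rankK_in B0 (cellB _ xd)) -(enum_rankK_in B0 (cellB _ yd)) e.
  rewrite enorm_leP; last by rewrite divr_ge0// ltW.
  apply: (@le_trans _ _ (\sum_(j < m) h ^+ 2)); last first.
    rewrite sumr_const card_ord -mulr_natl -ss /h le_eqVlt; apply/orP; left.
    by apply/eqP; field; rewrite !gt_eqF.
  apply: ler_sum => j _; rewrite !mxE -real_normK ?num_real//.
  rewrite ler_sqr ?nnegrE ?normr_ge0 ?(ltW h0)//.
  move/ffunP/(_ j): e; rewrite !ffunE => -[sxy /(congr1 val)].
  by rewrite /= !inordK ?coord_le//; exact: same_cell_dist.
Qed.

End EuclideanCells.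

(** * Integrals of logarithms and of their square roots *)

Section EntropyBoundIntegral.
Context (R : realType).
Local Notation leb := (@lebesgue_measure R).

(* No measurability: the supremum over Q in the entropy integral need not be
   measurable. *)
Lemma le_integral_nonmeas (d : measure_display) (T : measurableType d)
    (mu : {measure set T -> \bar R}) (D : set T) (f g : T -> \bar R) :
  (forall x, D x -> (0 <= f x)%E) -> (forall x, D x -> (f x <= g x)%E) ->
  (\int[mu]_(x in D) f x <= \int[mu]_(x in D) g x)%E.
Proof.
move=> f0 fg; rewrite !ge0_integralE//; last first.
  by move=> x Dx; apply: le_trans (f0 _ Dx) (fg _ Dx).
apply: le_ereal_sup => _ [h hf <-]; exists h => // x /=.
apply: le_trans (hf x) _; rewrite /patch; case: ifPn => // xD.
by apply: fg; rewrite inE in xD.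
Qed.

Lemma integral_log_itv_le (a b u e : R) : 0 <= a -> 0 <= b -> 0 < u -> u < e ->
  e <= 1 ->
  (\int[leb]_(t in `[u, e]) (a - b * ln t)%:E <= (e * (a + b - b * ln e))%:E)%E.
Proof.
move=> a0 b0 u0 ue e1.
pose F t := t * (a + b) - b * (t * ln t).
have dF (t : R) : 0 < t -> is_derive t 1 F (a - b * ln t).
  move=> t0; have dln := is_derive1_ln t0.
  rewrite /F; apply: is_derive_eq.
  rewrite /GRing.scale /= !mulr1 divff ?gt_eqF//; ring.
rewrite (@continuous_FTC2 _ _ F)//.
- rewrite -EFinB lee_fin /F.
  have : 0 <= u * (a + b) - b * (u * ln u).
    rewrite subr_ge0; apply: (@le_trans _ _ 0).
      have lnu : ln u <= 0 by apply: ln_le0; apply/ltW/(lt_le_trans ue).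
      by rewrite mulr_ge0_le0// mulr_ge0_le0// ltW.
    by rewrite mulr_ge0 ?addr_ge0// ltW.
  rewrite [e * (a + b - _)]mulrBr (mulrCA e b).
  by move: (u * _ - _) => x; rewrite lerBlDr lerDl.
- apply/continuous_in_subspaceT => t; rewrite inE/= in_itv/= => /andP[ut _].
  apply: cvgB; first exact: cvg_cst.
  by apply: cvgM; [exact: cvg_cst|apply: continuous_ln; apply: lt_le_trans ut].
- split.
  + move=> t; rewrite in_itv/= => /andP[ut _].
    by have [] := dF t (lt_trans u0 ut).
  + apply: cvg_at_right_filter; apply: differentiable_continuous.
    by apply/derivable1_diffP; have [] := dF u u0.
  + apply: cvg_at_left_filter; apply: differentiable_continuous.
    by apply/derivable1_diffP; have [] := dF e (lt_trans u0 ue).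
- move=> t; rewrite in_itv/= => /andP[ut _].
  by rewrite derive1E; have [_ ->] := dF t (lt_trans u0 ut).
Qed.

(** Monotone convergence along intervals exhausting ]0, e], since the bound on each of them does not
    depend on its left end. *)
Lemma integral_log_le (a b e : R) : 0 <= a -> 0 <= b -> 0 < e <= 1 ->
  (\int[leb]_(t in `]0%R, e]) (a - b * ln t)%:E
    <= (e * (a + b - b * ln e))%:E)%E.
Proof.
move=> a0 b0 /andP[e0 e1].
(* Dividing by n + 2 rather than n + 1 keeps the left end strictly below e already for n = 0. *)
pose I n := `[e / n.+2%:R, e]%classic : set R.
have In0 n : 0 < e / n.+2%:R by rewrite divr_gt0.
have IE : `]0%R, e]%classic = \bigcup_n I n.
  apply/seteqP; split => t /=; last first.
    move=> [n _]; rewrite /I /= !in_itv/= => /andP[h te]; rewrite te andbT.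
    exact: lt_le_trans h.
  rewrite in_itv/= => /andP[t0 te].
  exists (Num.truncn (e / t)) => //; rewrite /I /= in_itv/= te andbT.
  rewrite ler_pdivrMr// -ler_pdivrMl// mulrC.
  by apply: ltW; apply: lt_le_trans (truncnS_gt _) _; rewrite ler_nat.
have mf : measurable_fun setT (EFin \o (fun t : R => a - b * ln t)).
  apply/measurable_EFinP; apply: measurable_funB => //.
  by apply: measurable_funM.
rewrite IE.
have nd : nondecreasing_seq I.
  move=> n k nk; rewrite subsetEset => t; rewrite /I /= !in_itv/= => /andP[h te].
  rewrite te andbT; apply: le_trans h; rewrite ler_pM2l// lef_pV2 ?posrE//.
  by rewrite ler_nat !ltnS.
have f0 n t : I n t -> (0 <= (a - b * ln t)%:E)%E.
  rewrite /I /= in_itv/= lee_fin => /andP[_ te].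
  by rewrite subr_ge0 (le_trans _ a0)// mulr_ge0_le0// ln_le0// (le_trans te).
have cv : (\int[leb]_(t in I n) (a - b * ln t)%:E @[n --> \oo] -->
    \int[leb]_(t in \bigcup_n I n) (a - b * ln t)%:E)%E.
  apply: ge0_nondecreasing_set_cvg_integral => // n; first exact: measurable_itv.
  exact: measurable_funTS.
rewrite -(cvg_lim _ cv)//; apply: lime_le; first exact: cvgP cv.
apply: nearW => n; apply: integral_log_itv_le => //.
by rewrite ltr_pdivrMr// ltr_pMr// ltr1n.
Qed.

Lemma sqrtr_le_linear (y c : R) : 0 <= y -> 0 < c ->
  Num.sqrt y <= (y + c ^+ 2) / (2 * c).
Proof.
move=> y0 c0; rewrite ler_pdivlMr ?mulr_gt0//.
rewrite -{2}(sqr_sqrtr y0) -subr_ge0.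
have -> : Num.sqrt y ^+ 2 + c ^+ 2 - Num.sqrt y * (2 * c) =
  (Num.sqrt y - c) ^+ 2 by ring.
exact: sqr_ge0.
Qed.

(** Jensen's inequality made explicit: the mean of A - B ln t over ]0, e] is A + B (1 - ln e), and
    the root lies below its tangent at c ^ 2. *)
Lemma integral_sqrt_log_le (A B c e : R) : 0 <= A -> 0 <= B -> 0 < c ->
  0 < e <= 1 -> A + B * (1 - ln e) <= c ^+ 2 ->
  (\int[leb]_(t in `]0%R, e]) (Num.sqrt (A - B * ln t))%:E <= (e * c)%:E)%E.
Proof.
move=> A0 B0 c0 e01 h; have /andP[e0 e1] := e01.
have c20 : 0 < 2 * c by rewrite mulr_gt0.
pose a := (A + c ^+ 2) / (2 * c); pose b := B / (2 * c).
apply: (@le_trans _ _ (\int[leb]_(t in `]0%R, e]) (a - b * ln t)%:E)%E).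
  apply: le_integral_nonmeas => t /=; rewrite in_itv/= => /andP[t0 te].
    by rewrite lee_fin sqrtr_ge0.
  rewrite lee_fin.
  have y0 : 0 <= A - B * ln t.
    by rewrite subr_ge0 (le_trans _ A0)// mulr_ge0_le0// ln_le0// (le_trans te).
  apply: le_trans (sqrtr_le_linear y0 c0) _.
  rewrite /a /b mulrAC -mulrBl ler_wpM2r ?invr_ge0 ?(ltW c20)//.
  by rewrite addrAC.
apply: le_trans (integral_log_le _ _ e01) _.
- by rewrite /a divr_ge0 ?addr_ge0 ?sqr_ge0// ltW.
- by rewrite /b divr_ge0// ltW.
rewrite lee_fin ler_wpM2l ?(ltW e0)// /a /b (mulrAC B) -mulrDl -mulrBl.
rewrite ler_pdivrMr//.
have -> : A + c ^+ 2 + B - B * ln e = A + B * (1 - ln e) + c ^+ 2 by ring.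
have -> : c * (2 * c) = c ^+ 2 + c ^+ 2 by ring.
by rewrite lerD2r.
Qed.

End EntropyBoundIntegral.

(** * Finitely supported measures as weighted sums of atoms *)

Section FiniteSupport.
Context (d : measure_display) (T : measurableType d) (R : realType).
Hypothesis measurable_singleton : forall x : T, measurable [set x].

(** The complement of the support is negligible, and the support is a finite disjoint union of
    measurable singletons, on each of which the integrand is constant. *)
Lemma integral_finite_support (Q : probability T R) : finite_support Q ->
  exists2 s : seq T, uniq s &
    forall g : T -> \bar R, measurable_fun setT g -> (forall x, (0 <= g x)%E) ->
      (\int[Q]_x g x = \sum_(x <- s) g x * Q [set x])%E.
Proof.
move=> [A [/finite_seqP[s0 As0] mA QA]].
have As : A = \big[setU/set0]_(x <- undup s0) [set x].
  rewrite As0 -bigcup_seq; apply/seteqP; split => x /=.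
    by move=> xs; exists x => //=; rewrite mem_undup.
  by move=> [y /=]; rewrite mem_undup => ys ->.
exists (undup s0); first exact: undup_uniq.
move=> g mg g0.
have QNA : Q (~` A) = 0%E by rewrite probability_setC// QA subee.
rewrite (@ge0_negligible_integral _ _ _ Q setT (~` A))//; last exact: measurableC.
rewrite setTD setCK As ge0_integral_bigsetU//.
- apply: eq_bigr => x _.
  rewrite -(integral_cst Q (measurable_singleton x)).
  by apply: eq_integral => y; rewrite inE => ->.
- exact: undup_uniq.
- by move=> x y _ _ [z []] /= -> ->.
- exact: measurable_funTS.
Qed.

Lemma L2norm_finite_support (Q : probability T R) : finite_support Q ->
  exists (n : nat) (p : 'I_n -> T) (q : 'I_n -> R),
    [/\ forall j, 0 <= q j, \sum_j q j = 1 &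
      forall f : T -> R, measurable_fun setT f ->
        L2norm Q f = (Num.sqrt (\sum_j q j * f (p j) ^+ 2))%:E].
Proof.
move=> /integral_finite_support[s us intE].
pose q x := fine (Q [set x]).
have qE x : Q [set x] = (q x)%:E.
  by rewrite fineK//; apply: fin_num_measure.
exists (size s), (tnth (in_tuple s)), (fun j => q (tnth (in_tuple s) j)); split.
- by move=> j; rewrite fine_ge0.
- rewrite -(big_tnth _ _ s xpredT q); apply: EFin_inj.
  rewrite -sumEFin -(@probability_setT _ _ _ Q) -[RHS]mul1e -integral_cst// intE//.
  by apply: eq_bigr => x _; rewrite mul1e qE.
- move=> f mf.
  have -> : \sum_j q (tnth (in_tuple s) j) * f (tnth (in_tuple s) j) ^+ 2 =
      \sum_(x <- s) q x * f x ^+ 2.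
    by rewrite (big_tnth _ _ s xpredT (fun x => q x * f x ^+ 2)).
  have sum0 : (0 <= \sum_(x <- s) q x * f x ^+ 2)%R.
    by apply: sumr_ge0 => x _; rewrite mulr_ge0 ?sqr_ge0// fine_ge0.
  rewrite /L2norm unlock /=.
  have -> : (\int[Q]_x (`|(f x)%:E| `^ 2) = (\sum_(x <- s) q x * f x ^+ 2)%:E)%E.
    under eq_integral do rewrite /= powR_mulrn// real_normK ?num_real//.
    rewrite intE.
    + rewrite -sumEFin; apply: eq_bigr => x _.
      by rewrite qE -EFinM mulrC.
    + by apply/measurable_EFinP; apply: measurable_funX.
    + by move=> x; rewrite lee_fin sqr_ge0.
  by rewrite poweR12_sqrt.
Qed.

End FiniteSupport.

(** * Envelope and finite covers for piecewise Hölder functions *)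

Section PiecewiseHolder.
Context (R : realType) (m r : nat) (T : Type) (Theta : set 'rV[R]_m).
Variables (thstar : 'rV[R]_m) (hthstar : Theta thstar).
Variables (B : 'I_r -> 'rV[R]_m -> set T).
Hypothesis hB : forall th, Theta th -> partition_of_setT (fun i => B i th).
Variables (Gi : 'I_r -> 'rV[R]_m -> T -> R) (beta : 'I_r -> R).
Hypothesis hbeta : forall i, 0 < beta i <= 1.
Variable C : 'I_r -> T -> R.
Hypothesis C_gt0 : forall i z, 0 < C i z.
Hypothesis holder : forall i z th vt, Theta th -> Theta vt ->
  `|Gi i th z - Gi i vt z| <= C i z * enorm (th - vt) `^ beta i.
Variable G : 'rV[R]_m -> T -> R.
Hypothesis hG : forall th z, Theta th ->
  G th z = \sum_(i < r) \1_(B i th) z * Gi i th z.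
Variables (delta : R) (hdelta : 0 < delta) (Bhat : 'I_r -> set T).
Hypothesis hBhat : forall i, symdiff_union Theta thstar delta (B i) `<=` Bhat i.

Local Notation xiG := (xi beta C (fun i => Gi i thstar) Bhat delta).
Local Notation U := (nbh Theta thstar delta).

Lemma xi_term_ge0 i z : 0 <= 2 * delta `^ beta i * C i z
  + `|Gi i thstar z| * \1_(Bhat i) z + Num.min delta 1 ^+ 2.
Proof.
by rewrite !addr_ge0 ?sqr_ge0// mulr_ge0 ?powR_ge0 ?mulr_ge0 ?powR_ge0// ltW.
Qed.

Lemma xi_ge_holder i z : 2 * delta `^ beta i * C i z <= xiG z.
Proof.
rewrite /xi (bigD1 i)//= -addrA -addrA lerDl addr_ge0 ?mulr_ge0//.
by rewrite addr_ge0 ?sqr_ge0// sumr_ge0// => j _; exact: xi_term_ge0.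
Qed.

Lemma xi_gt0 z : (0 < r)%N -> 0 < xiG z.
Proof.
move=> r0; apply: lt_le_trans (xi_ge_holder (Ordinal r0) z).
by rewrite !mulr_gt0// powR_gt0.
Qed.

(** Term by term: if z is in both or neither of the two i-th pieces, the Hölder bound is enough.
    Otherwise z is in the symmetric difference, hence in [Bhat i], and the indicator term of the
    envelope pays for [Gi i thstar z]. *)
Lemma increment_le_xi th z : U th -> `|G th z - G thstar z| <= xiG z.
Proof.
move=> Uth; have [tT thd] := Uth; rewrite !hG// -sumrB.
apply: le_trans (ler_norm_sum _ _ _) _; rewrite /xi; apply: ler_sum => i _.
have hold : `|Gi i th z - Gi i thstar z| <= delta `^ beta i * C i z.
  apply: le_trans (holder _ _ tT hthstar) _; rewrite mulrC ler_wpM2r ?(ltW (C_gt0 _ _))//.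
  apply: ge0_ler_powR => //; rewrite ?nnegrE ?sqrtr_ge0 ?(ltW hdelta)//.
  by case/andP: (hbeta i) => /ltW.
have hold2 : delta `^ beta i * C i z <= 2 * delta `^ beta i * C i z.
  rewrite -mulrA -[leLHS]mul1r ler_wpM2r ?ler1n//.
  by rewrite mulr_ge0 ?powR_ge0// ltW.
have sq0 : 0 <= Num.min delta 1 ^+ 2 by exact: sqr_ge0.
have hat : symdiff (B i th) (B i thstar) z -> Bhat i z.
  by move=> h; apply: hBhat; exists th.
have c0 : 0 <= `|Gi i thstar z| * \1_(Bhat i) z by rewrite mulr_ge0.
rewrite !indicE.
have [B1|B1] := pselect (B i th z); have [B2|B2] := pselect (B i thstar z).
- rewrite (mem_set B1) (mem_set B2) !mul1r; apply: le_trans hold _.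
  by apply: (le_trans hold2); rewrite -addrA lerDl addr_ge0.
- rewrite (mem_set B1) (memNset B2) (mem_set (hat _)); last by left.
  rewrite /=.
  rewrite mul1r mul0r subr0 mulr1 -(subrK (Gi i thstar z) (Gi i th z)).
  apply: le_trans (ler_normD _ _) _.
  by rewrite -addrA lerD ?lerDl// (le_trans hold).
- rewrite (memNset B1) (mem_set B2) (mem_set (hat _)); last by right.
  rewrite /=.
  rewrite mul1r mul0r sub0r normrN mulr1.
  rewrite addrAC lerDr addr_ge0//.
  by rewrite !mulr_ge0 ?powR_ge0// ltW.
- rewrite (memNset B1) (memNset B2) !mul0r subr0 normr0.
  by have := xi_term_ge0 i z; rewrite indicE.
Qed.

Lemma piece_value th i z : Theta th -> B i th z -> G th z = Gi i th z.
Proof.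
move=> tT Bz; rewrite hG// (bigD1 i)//= indicE mem_set// mul1r big1 ?addr0// => j ji.
rewrite indicE memNset ?mul0r// => Bj.
have [_ tri] := hB tT; move/eqP: ji; apply.
by apply: tri => //; exists z.
Qed.

(** With b the sum of all 1 / beta_i, each b * beta_i is at least 1, so K ^ (- beta_i) = eta ^ (b *
    beta_i) <= eta whatever piece contains z. The factor 2 in the envelope gives eta / 2. *)
Lemma same_piece_diff_le th vt z eta K :
  Theta th -> Theta vt -> (forall i, B i th z -> B i vt z) ->
  0 < eta <= 1 -> enorm (th - vt) <= delta / K ->
  K = (eta `^ (\sum_(i < r) (beta i)^-1))^-1 ->
  `|G th z - G vt z| <= eta / 2 * xiG z.
Proof.
move=> tT vT Bsub /andP[eta0 eta1] dK KE.
have [cov _] := hB tT.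
have [i _ Bi] : (\bigcup_i B i th) z by rewrite cov.
rewrite (piece_value tT Bi) (piece_value vT (Bsub _ Bi)).
have /andP[b0 b1] := hbeta i.
apply: le_trans (holder _ _ tT vT) _.
apply: (@le_trans _ _ (C i z * (delta `^ beta i * eta))); last first.
  have := ler_wpM2l (ltW (divr_gt0 eta0 (ltr0n R 2))) (xi_ge_holder i z).
  by apply: le_trans; rewrite le_eqVlt; apply/orP; left; apply/eqP; field.
rewrite ler_wpM2l ?(ltW (C_gt0 _ _))//.
apply: (@le_trans _ _ ((delta / K) `^ beta i)).
  apply: ge0_ler_powR; rewrite ?nnegrE ?sqrtr_ge0 ?(ltW b0)//.
  by rewrite KE invrK mulr_ge0 ?powR_ge0// ltW.
rewrite KE invrK powRM ?powR_ge0 ?(ltW hdelta)// ler_wpM2l ?powR_ge0//.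
rewrite -powRrM -[leRHS]powRr1 ?(ltW eta0)//.
apply: ger_powR; first by rewrite eta0.
rewrite (bigD1 i)//= mulrDl mulVf ?gt_eqF// lerDl mulr_ge0 ?(ltW b0)//.
by apply: sumr_ge0 => j _; rewrite invr_ge0; case/andP: (hbeta j) => /ltW.
Qed.

(* Two parameters in the same grid cell and with the same cluster of sign patterns:
   where the patterns agree the increments differ by eta / 2 * xi, and elsewhere by
   at most 2 * xi. *)
Lemma finite_cover (X : finType) (pat : 'rV[R]_m -> T -> {set X})
    (n : nat) (p : 'I_n -> T) (q : 'I_n -> R) (eta : R) :
  (0 < m)%N -> (0 < r)%N -> (0 < #|X|)%N ->
  (forall th vt z, pat th z = pat vt z -> forall i, B i th z -> B i vt z) ->
  (forall k (f : 'I_k -> X * T),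
     (forall A : {set 'I_k},
        exists2 t, U t & forall j, ((f j).1 \in pat t (f j).2) = (j \in A)) ->
     (k <= m)%N) ->
  (forall j, 0 <= q j) -> \sum_j q j = 1 -> 0 < eta <= 1 ->
  exists (N : nat) (c : 'I_N -> 'rV[R]_m),
    [/\ (0 < N)%N,
        ln N%:R <= m%:R * (ln 2 + 2 - (\sum_(i < r) (beta i)^-1) * ln eta)
          + 2 * m%:R * (ln (64 * #|X|%:R) - 2 * ln eta) + 1 / 2,
        forall k, U (c k) &
        forall th, U th -> exists k,
          \sum_j q j * (G th (p j) - G (c k) (p j)) ^+ 2
            <= eta ^+ 2 * \sum_j q j * xiG (p j) ^+ 2].
Proof.
move=> m0 r0 X0 patB vc q0 q1 eta01; have /andP[eta0 eta1] := eta01.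
pose S : R := #|X|%:R.
have S1 : 1 <= S by rewrite ler1n.
have S0 : 0 < S by apply: lt_le_trans S1.
pose W := \sum_j q j * xiG (p j) ^+ 2.
have W_ge0 j : 0 <= q j * xiG (p j) ^+ 2 by rewrite mulr_ge0 ?sqr_ge0.
have W0 : 0 < W.
  rewrite lt_def sumr_ge0// andbT psumr_eq0//; apply/negP => /allP all0.
  have : \sum_j q j = 0.
    apply: big1 => j _; have := all0 j (mem_index_enum j).
    by rewrite /= mulf_eq0 sqrf_eq0 (gt_eqF (xi_gt0 _ r0)) orbF => /eqP.
  by rewrite q1 => /eqP; rewrite oner_eq0.
(* Each atom is weighted by its share of the squared norm W of the envelope, once for each of the S
   elements of X. *)
pose w (x : X * 'I_n) := q x.2 * xiG (p x.2) ^+ 2 / (S * W).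
have SW0 : 0 < S * W by rewrite mulr_gt0.
have w0 x : 0 <= w x by rewrite divr_ge0// ltW.
have w1 : \sum_x w x = 1.
  rewrite /w -mulr_suml.
  rewrite -(pair_bigA _ (fun (_ : X) j => q j * xiG (p j) ^+ 2)) /=.
  by rewrite sumr_const -mulr_natl divff// gt_eqF.
(* Differing patterns will cost at most 4 S W * 2 k = eta ^ 2 W / 2, and the grid at most eta ^ 2 W
   / 4. *)
pose k := eta ^+ 2 / (16 * S).
have k01 : 0 < k <= 1.
  rewrite divr_gt0 ?exprn_gt0 ?mulr_gt0//= ler_pdivrMr ?mulr_gt0// mul1r.
  apply: (@le_trans _ _ 1); first by rewrite expr_le1// ltW.
  by rewrite -[leLHS]mulr1 ler_pM// ler1n.
pose spat th : {set X * 'I_n} := [set x | x.1 \in pat th (p x.2)]%SET.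
have U0 : U thstar.
  split => //; rewrite subrr enorm_leP ?(ltW hdelta)// big1 ?sqr_ge0// => j _.
  by rewrite mxE expr0n.
have [k' f sh|M2 [c2 [M20 lnM2 c2P]]] :=
    pattern_classes (U := U) (pat := spat) (m := m) w0 w1 k01 (ex_intro _ _ U0).
  apply: (vc k' (fun j => ((f j).1, p (f j).2))) => A.
  by have [t Ut h] := sh A; exists t => // j; rewrite -h inE.
pose b := \sum_(i < r) (beta i)^-1.
have b0 : 0 <= b.
  by apply: sumr_ge0 => j _; rewrite invr_ge0; case/andP: (hbeta j) => /ltW.
pose K := (eta `^ b)^-1.
have K1 : 1 <= K.
  rewrite /K invf_ge1 ?powR_gt0// -[leRHS](powRr0 eta).
  by apply: ger_powR; rewrite ?eta0.
have [M1 [c1 [M10 lnM1 c1P]]] := euclidean_cells m0 hdelta K1.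
pose cls th := (c1 (th - thstar), c2 th).
(* One representative per class; a class that misses U gets [thstar], so that all centres lie in
   U. *)
have /choice[c cP] : forall x : 'I_M1 * 'I_M2, exists t,
    U t /\ forall th, U th -> cls th = x -> cls t = x.
  move=> x.
  have [[t [Ut tx]]|none] := pselect (exists t, U t /\ cls t = x).
    by exists t; split => // th _ _.
  by exists thstar; split => // th Uth thx; case: none; exists th.
exists #|{: 'I_M1 * 'I_M2}|, (fun l => c (enum_val l)); split.
- by rewrite card_prod !card_ord muln_gt0 M10.
- rewrite card_prod !card_ord natrM lnM ?posrE ?ltr0n//.
  rewrite -addrA; apply: lerD.
    by rewrite (_ : - _ = ln K)// /K lnV ?posrE ?powR_gt0// ln_powR.
  apply: le_trans lnM2 _; apply: lerD; last first.
    by rewrite ler_pM2r ?invr_gt0//; case/andP: k01.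
  have -> : 4 / k = 64 * S / eta ^+ 2.
    by rewrite /k invf_div; field; rewrite gt_eqF.
  by rewrite ln_div ?posrE ?mulr_gt0 ?exprn_gt0// lnXn// (mulr_natl (ln eta) 2).
- by move=> l; case: (cP (enum_val l)).
move=> th Uth; exists (enum_rank (cls th)); rewrite enum_rankK.
have [Uu /(_ _ Uth erefl)] := cP (cls th); set u := c _ in Uu *.
move=> [c1u c2u]; have [tT thd] := Uth; have [uT ud] := Uu.
have duK : enorm (th - u) <= delta / K.
  have -> : th - u = (th - thstar) - (u - thstar) by rewrite opprB addrA subrK.
  exact: c1P.
pose D (x : X * 'I_n) := (x \in spat th) != (x \in spat u).
have pointwise j : q j * (G th (p j) - G u (p j)) ^+ 2 <=
    eta ^+ 2 / 4 * (q j * xiG (p j) ^+ 2)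
    + 4 * \sum_x (D (x, j))%:R * (q j * xiG (p j) ^+ 2).
  set z := p j; have xi0 := xi_gt0 z r0.
  have sumD0 : 0 <= \sum_x (D (x, j))%:R * (q j * xiG z ^+ 2).
    by apply: sumr_ge0 => x _; rewrite mulr_ge0 ?W_ge0.
  have [same|/eqP] := eqVneq (pat th z) (pat u z).
    have le1 := same_piece_diff_le tT uT (patB _ _ _ same) eta01 duK erefl.
    rewrite -[leLHS]addr0 lerD ?mulr_ge0// [leRHS]mulrCA; apply: ler_wpM2l => //.
    rewrite -(real_normK (num_real (G th z - _))).
    have -> : eta ^+ 2 / 4 * xiG z ^+ 2 = (eta / 2 * xiG z) ^+ 2 by field.
    by rewrite ler_sqr ?nnegrE// !mulr_ge0// ltW.
  (* A single x on which the patterns differ pays for the crude bound (2 xi) ^ 2. *)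
  move=> diff; have [x Dx] : exists x, D (x, j).
    apply: contrapT => none; apply: diff; apply/finset.setP => x.
    by apply/eqP; apply: contrapT => /negP xn; apply: none; exists x; rewrite /D !inE.
  rewrite -[leLHS]add0r; apply: lerD.
    by apply: mulr_ge0; [rewrite divr_ge0 ?sqr_ge0|exact: W_ge0].
  apply: (@le_trans _ _ (4 * (q j * xiG z ^+ 2))); last first.
    rewrite ler_pM2l// (bigD1 x)//= Dx mul1r lerDl.
    by apply: sumr_ge0 => y _; rewrite mulr_ge0 ?W_ge0.
  rewrite [leRHS]mulrCA; apply: ler_wpM2l => //.
  rewrite -(real_normK (num_real (G th z - _))).
  have -> : 4 * xiG z ^+ 2 = (xiG z + xiG z) ^+ 2 by ring.
  rewrite ler_sqr ?nnegrE ?addr_ge0 ?(ltW xi0)//.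
  rewrite -(subrK (G thstar z) (G th z)) -addrA.
  apply: le_trans (ler_normD _ _) _; apply: lerD; first exact: increment_le_xi.
  by rewrite distrC; exact: increment_le_xi.
rewrite -/W; apply: le_trans (ler_sum _ (fun j _ => pointwise j)) _.
rewrite big_split /= -mulr_sumr -/W -mulr_sumr.
have -> : \sum_j \sum_x (D (x, j))%:R * (q j * xiG (p j) ^+ 2) =
    S * W * \sum_(x | D x) w x.
  rewrite exchange_big /=.
  rewrite (pair_bigA _ (fun x j => (D (x, j))%:R * (q j * xiG (p j) ^+ 2))) /=.
  rewrite mulr_sumr [RHS]big_mkcond /=; apply: eq_bigr => -[x j] _ /=.
  by case: (D _); rewrite ?mul0r// mul1r /w /= [RHS]mulrC divfK// gt_eqF.
have := c2P _ _ Uth Uu (esym c2u); rewrite -/(D _).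
(* Taking 3 k for the available 2 k uses up the slack and makes the split exact. *)
have -> : eta ^+ 2 * W = eta ^+ 2 / 4 * W + 4 * (S * W * (3 * k)).
  by rewrite /k; field; rewrite gt_eqF.
move=> le2k; rewrite lerD2l ler_pM2l// ler_pM2l//.
apply: le_trans le2k _; rewrite ler_wpM2r ?ler_nat//.
by case/andP: k01 => /ltW.
Qed.

End PiecewiseHolder.

(** * Measurability of points, sections and pieces *)

Section BorelMeasurability.
Context (R : realType).

Lemma borel_measurable_singleton (d : nat) (x : borel 'rV[R]_d) :
  measurable [set x].
Proof.
rewrite -[X in measurable X]setCK; apply: measurableC.
apply: sub_sigma_algebra; rewrite openC.
exact: (accessible_closed_set1 (hausdorff_accessible (@norm_hausdorff R 'rV[R]_d))).
Qed.

(** The map from z to (th, z) is continuous, hence measurable for the Borel sets of the product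
    topology. *)
Lemma measurable_fun_section (m d : nat)
    (f : 'rV[R]_m -> borel 'rV[R]_d -> R) (th : 'rV[R]_m) :
  measurable_fun setT (fun p : borel ('rV[R]_m * 'rV[R]_d)%type => f p.1 p.2) ->
  measurable_fun setT (f th).
Proof.
move=> mf.
have mpair : measurable_fun setT
    ((fun z => (th, z)) : borel 'rV[R]_d -> borel ('rV[R]_m * 'rV[R]_d)%type).
  apply: (@measurability _ _ (borel 'rV[R]_d) (borel ('rV[R]_m * 'rV[R]_d)%type)
    setT (fun z => (th, z)) (@open ('rV[R]_m * 'rV[R]_d)%type)); first by [].
  move=> _ [V oV <-]; rewrite setTI; apply: sub_sigma_algebra.
  have ct : continuous (fun z : 'rV[R]_d => (th, z)).
    move=> z; exact: (@cvg_pair _ _ _ (nbhs z) (nbhs th) (nbhs z) _ _ _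
      (fun _ => th) id (cvg_cst _) cvg_id).
  by apply: (@open_comp 'rV[R]_d _ (fun z => (th, z)) V) => // z _; exact: ct.
exact: (measurableT_comp mf mpair).
Qed.

Lemma measurable_piece (d : measure_display) (T : measurableType d) (m s : nat)
    (I : 'I_s -> set R) (a : 'I_s -> R) (Lam : 'I_s -> 'rV[R]_m -> T -> R)
    (th : 'rV[R]_m) :
  (forall l, I l = `]0, +oo[%classic \/ I l = `[0, +oo[%classic) ->
  (forall l, measurable_fun setT (Lam l th)) ->
  measurable (piece I a Lam th).
Proof.
move=> hI mL; apply: fin_bigcap_measurable => [|l _]; first exact: finite_finset.
have mLa : measurable_fun setT (fun z => Lam l th z + a l).
  exact: measurable_funD.
rewrite -[X in measurable X]setTI; apply: (mLa measurableT (I l)).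
by case: (hI l) => ->; exact: measurable_itv.
Qed.

End BorelMeasurability.

(** * Numerical comparison of the constants *)

Section EntropyConstants.
Context (R : realType).

Lemma ln2_ge_half : 1 / 2 <= ln 2 :> R.
Proof.
have : ln (1 + (- 2^-1)) <= - 2^-1 :> R by apply: le_ln1Dx; lra.
have -> : 1 + (- 2^-1) = 2^-1 :> R by field.
by rewrite lnV ?posrE// lerN2 mul1r.
Qed.

Lemma ln_le_subr1 (x : R) : 0 < x -> ln x <= x - 1.
Proof.
move=> x0; rewrite -[X in ln X](subrKC 1); apply: le_ln1Dx.
by rewrite ltrBrDr addrC subrr.
Qed.

(** Trades the logarithm of the number of half-spaces for a linear term that [d_coef] can absorb. *)
Lemma ln64M_le (x : R) : 0 < x -> ln (64 * x) <= 5 + x.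
Proof.
move=> x0; rewrite lnM ?posrE//.
have -> : 64 = 2 ^+ 6 :> R by rewrite -natrX.
have := ln_le_subr1 x0; have := ln_le_subr1 (ltr0n R 2).
by rewrite lnXn// -[ln 2 *+ 6]mulr_natr; lra.
Qed.

Lemma ln_8r_ge (r : nat) (e : R) : (0 < r)%N -> 0 < e ->
  2 - ln e <= ln (8 * (r%:R + 1) / e).
Proof.
move=> r0 e0; rewrite ln_div ?posrE ?mulr_gt0// ?addr_gt0 ?ltr0n// lerD2r.
apply: (@le_trans _ _ (ln (2 ^+ 4))).
  by rewrite lnXn// -[ln 2 *+ 4]mulr_natr; have := ln2_ge_half; lra.
rewrite ler_ln ?posrE ?exprn_gt0 ?mulr_gt0 ?addr_gt0 ?ltr0n//.
have : 1 <= r%:R :> R by rewrite ler1n.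
by lra.
Qed.

(** Used with S the number of half-spaces and lam = - ln e; the two summands on the right are the
    radicands of the theorem. The term in m b is paid for by m L b since 1 + lam <= L, and the
    remaining multiples of m mostly by m S and m S L since 1 <= S. *)
Lemma entropy_constants_le (r m S b l2 l3 l64 L lam : R) :
  1 <= r -> 1 <= m -> 1 <= S -> 0 <= b -> l2 <= 1 -> 0 <= l2 -> 0 <= l3 ->
  l64 <= 5 + S -> 0 <= lam -> 2 + lam <= L ->
  l2 + m * (l2 + 2) + 2 * m * l64 + 1 / 2 + (m * b + 4 * m) * (1 + lam) <=
  4 * ((r + l2 + (2 * r * m * l3 + m * L * b) + (5 + 2 * L) * ((m + 2) * S))
       + (r + 4 * (1 + L) * ((m + 2) * S))).
Proof.
move=> r1 m1 S1 b0 l21 l20 l30 l64S lam0 Ll.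
have m0 : 0 <= m by apply: le_trans m1.
have h1 : m * l2 <= m by rewrite -[leRHS]mulr1 ler_wpM2l.
have h2 : m * l64 <= m * (5 + S) by rewrite ler_wpM2l.
have h3 : (m * b) * (1 + lam) <= (m * b) * L.
  by rewrite ler_wpM2l ?mulr_ge0//; lra.
have h3' : 0 <= (m * b) * L by rewrite !mulr_ge0//; lra.
have h4 : 0 <= r * m * l3 by rewrite !mulr_ge0//; lra.
have h5 : m * (1 + lam) <= m * S * L.
  rewrite -mulrA ler_wpM2l//; apply: (@le_trans _ _ (1 * L)); first lra.
  by rewrite ler_wpM2r//; lra.
have h6 : m <= m * S by rewrite -[leLHS]mulr1 ler_wpM2l.
have h7 : 0 <= S * L by rewrite mulr_ge0//; lra.
have h8 : 0 <= m * S * L by rewrite !mulr_ge0//; lra.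
have -> : (m * b + 4 * m) * (1 + lam) = m * b * (1 + lam) + 4 * (m * (1 + lam)) by ring.
have -> : 2 * m * l64 = 2 * (m * l64) by ring.
have -> : m * (l2 + 2) = m * l2 + 2 * m by ring.
have -> : 4 * ((r + l2 + (2 * r * m * l3 + m * L * b) + (5 + 2 * L) * ((m + 2) * S))
       + (r + 4 * (1 + L) * ((m + 2) * S))) =
  8 * r + 4 * l2 + 8 * (r * m * l3) + 4 * (m * b * L) + 36 * (m * S) + 72 * S
  + 24 * (m * S * L) + 48 * (S * L) by ring.
have e2 : m * (5 + S) = 5 * m + m * S by ring.
rewrite e2 in h2.
(* Products become opaque atoms, so that the remaining inequality is linear. *)
move: (m * l2) (m * l64) (m * b * (1 + lam)) (m * b * L) (r * m * l3)
  (m * (1 + lam)) (m * S * L) (m * S) (S * L) h1 h2 h3 h3' h4 h5 h6 h7 h8.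
clear e2 Ll l64S b0; move=> *; lra.
Qed.

End EntropyConstants.

(** * From covers to the entropy integral *)

Lemma ediam_gt0_dim (R : realType) (m : nat) (A : set 'rV[R]_m) :
  (0 < ediam A)%E -> (0 < m)%N.
Proof.
case: m A => // A; rewrite ltNge => /negP[]; apply: ge_ereal_sup => _ [x _ <-].
by rewrite lee_fin /enorm big_ord0 sqrtr0.
Qed.

Lemma card_sigma_ord (r : nat) (s : 'I_r -> nat) :
  #|{: {i : 'I_r & 'I_(s i)}}| = (\sum_(i < r) s i)%N.
Proof.
rewrite card_tagged sumnE big_map big_enum /=.
by apply: eq_bigr => i _; rewrite card_ord.
Qed.

Lemma covering_number_le (d : measure_display) (T : measurableType d)
    (R : realType) (Q : probability T R) (F : set (T -> R)) (eta : \bar R)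
    (N : nat) (b : R) :
  covered_by Q F eta N -> (0 < N)%N -> ln 2 + ln N%:R <= b ->
  (sqrte (lne (2%:R%:E * covering_number Q F eta)) <= (Num.sqrt b)%:E)%E.
Proof.
move=> cov N0 Nb.
have N0' : 0 < N%:R :> R by rewrite ltr0n.
have b0 : 0 <= b.
  by apply: le_trans Nb; rewrite addr_ge0// ln_ge0// ler1n.
rewrite -[leRHS]/(sqrte b%:E) lee_sqrt ?lee_fin//.
have cN0 : (0 <= covering_number Q F eta)%E.
  by apply: le_ereal_inf_tmp => _ [k _ <-]; rewrite lee_fin.
have cN : (covering_number Q F eta <= N%:R%:E)%E.
  by apply: ereal_inf_lbound; exists N.
apply: (@le_trans _ _ (lne (2 * N%:R)%:E)).
  rewrite lee_lne ?in_itv/= ?leey ?andbT ?lee_fin ?mulr_ge0 ?mule_ge0//.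
  by rewrite EFinM lee_wpmul2l.
by rewrite lne_EFin ?mulr_gt0// lnM ?posrE.
Qed.

Fact log_cover_arith (R : realType) (l2 m b l l64 : R) :
  l2 + (m * (l2 + 2 - b * l) + 2 * m * (l64 - 2 * l) + 1 / 2) =
  l2 + m * (l2 + 2) + 2 * m * l64 + 1 / 2 - (m * b + 4 * m) * l.
Proof. by ring. Qed.

(** The cross term of the square is dropped; the square is c ^ 2 for the constant c of the
    theorem. *)
Lemma four_sum_le_sqr (R : realType) (x y : R) : 0 <= x -> 0 <= y ->
  4 * (x + y) <= (2 * Num.sqrt x + 2 * Num.sqrt y) ^+ 2.
Proof.
move=> x0 y0; rewrite -{1}(sqr_sqrtr x0) -{1}(sqr_sqrtr y0) -subr_ge0.
have -> : (2 * Num.sqrt x + 2 * Num.sqrt y) ^+ 2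
    - 4 * (Num.sqrt x ^+ 2 + Num.sqrt y ^+ 2) = 8 * (Num.sqrt x * Num.sqrt y) by ring.
by rewrite !mulr_ge0 ?sqrtr_ge0.
Qed.

Theorem proposition5p4 (R : realType) (m d : nat) (hd : (0 < d)%N)
  (dO : measure_display) (Omega : measurableType dO) (P : probability Omega R)
  (Z : {RV P >-> borel 'rV[R]_d})
  (Theta : set 'rV[R]_m) (hTheta : compact Theta) (hdiam : (0 < ediam Theta)%E)
  (thstar : 'rV[R]_m) (hthstar : Theta thstar)
  (r : nat) (hr : (0 < r)%N) (s : 'I_r -> nat) (hs : forall i, (0 < s i)%N)
  (a : forall i, 'I_(s i) -> R)
  (I : forall i, 'I_(s i) -> set R)
  (hI : forall i l, I i l = `]0, +oo[%classic \/ I i l = `[0, +oo[%classic)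
  (Lam : forall i, 'I_(s i) -> 'rV[R]_m -> borel 'rV[R]_d -> R)
  (hLam_meas : forall i l, measurable_fun setT
     (fun p : borel ('rV[R]_m * 'rV[R]_d)%type => Lam i l p.1 p.2))
  (hLam_affine : forall i l z, affine_fun (fun th => Lam i l th z))
  (hB : forall th, Theta th ->
     partition_of_setT (fun i => piece (I i) (a i) (Lam i) th))
  (Gi : 'I_r -> 'rV[R]_m -> borel 'rV[R]_d -> R)
  (hGi_meas : forall i th, Theta th -> measurable_fun setT (Gi i th))
  (hGi_int : forall i th, Theta th ->
     (distribution P Z).-integrable setT (EFin \o Gi i th))
  (hGi_cvg : forall i (thk : nat -> 'rV[R]_m) (th : 'rV[R]_m),
     (forall k, Theta (thk k)) -> Theta th -> thk k @[k --> \oo] --> th ->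
     cvg_in_prob (distribution P Z) (fun k => Gi i (thk k)) (Gi i th))
  (beta : 'I_r -> R) (hbeta : forall i, 0 < beta i <= 1)
  (C : 'I_r -> borel 'rV[R]_d -> R)
  (hC_pos : forall i z, 0 < C i z)
  (hC_meas : forall i, measurable_fun setT (C i))
  (hC_int : forall i, (distribution P Z).-integrable setT
     (fun z => ((C i z) ^+ 2)%:E))
  (hGi_holder : forall i z th vt, Theta th -> Theta vt ->
     `|Gi i th z - Gi i vt z| <= C i z * enorm (th - vt) `^ beta i)
  (G : 'rV[R]_m -> borel 'rV[R]_d -> R)
  (hG : forall th z, Theta th ->
     G th z = \sum_(i < r) \1_(piece (I i) (a i) (Lam i) th) z * Gi i th z)
  (delta : R) (hdelta : 0 < delta)
  (Bhat : 'I_r -> set (borel 'rV[R]_d))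
  (hBhat_meas : forall i, measurable (Bhat i))
  (hBhat : forall i,
     symdiff_union Theta thstar delta (piece (I i) (a i) (Lam i))
       `<=` Bhat i) :
  let F := increment_class Theta thstar delta G in
  let xiG := xi beta C (fun i => Gi i thstar) Bhat delta in
  let L := fun e : R => ln (8 * (r%:R + 1) / e) in
  let D := (d_coef m s)%:R : R in
  positive_envelope F xiG /\
  forall e : R, 0 < e < 1 ->
    (entropy_integral F xiG e <=
      (2 * e * Num.sqrt (r%:R + ln 2 + c_coef m beta e + (5 + 2 * L e) * D)
       + 2 * e * Num.sqrt (r%:R + 4 * (1 + L e) * D))%:E)%E.
Proof.
move=> F xiG L D.
(* Dimension 0 is ruled out because the grid mesh divides by sqrt m. *)
have m0 := ediam_gt0_dim hdiam.
pose B i th := piece (I i) (a i) (Lam i) th.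
have hG' th z : Theta th -> G th z = \sum_(i < r) \1_(B i th) z * Gi i th z by exact: hG.
have mB i th : measurable (B i th).
  by apply: measurable_piece => // l; exact: measurable_fun_section.
have mG th : Theta th -> measurable_fun setT (G th).
  move=> tT; rewrite (_ : G th = fun z => \sum_(i < r) \1_(B i th) z * Gi i th z).
    apply: measurable_sum => i; apply: measurable_funM; last exact: hGi_meas.
    exact: measurable_indic.
  by apply/funext => z; exact: hG'.
have minc th vt : Theta th -> Theta vt -> measurable_fun setT (fun z => G th z - G vt z).
  by move=> tT vT; apply: measurable_funB; exact: mG.
have mxi : measurable_fun setT xiG.
  apply: measurable_sum => i; apply: measurable_funD => //.
  apply: measurable_funD; apply: measurable_funM => //.
    by apply: measurableT_comp => //; exact: hGi_meas.
have xiP z : 0 < xiG z by exact: xi_gt0.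
split.
  split => //.
  - by move=> _ [th [tT _] <-]; exact: minc.
  - move=> _ [th Uth <-] z.
    exact: (increment_le_xi hthstar hbeta hC_pos hGi_holder hG' hdelta hBhat z Uth).
move=> e /andP[e0 e1].
pose b := \sum_(i < r) (beta i)^-1.
have b0 : 0 <= b.
  by apply: sumr_ge0 => j _; rewrite invr_ge0; case/andP: (hbeta j) => /ltW.
pose X := {: {i : 'I_r & 'I_(s i)}}.
pose S : R := #|X|%:R.
have X0 : (0 < #|X|)%N.
  rewrite card_sigma_ord; have := hs (Ordinal hr).
  by rewrite (bigD1 (Ordinal hr))//= addn_gt0 => ->.
have S1 : 1 <= S by rewrite ler1n.
have S0 : 0 < S by apply: lt_le_trans S1.
have ln2_ge0 : 0 <= ln 2 :> R by rewrite ln_ge0// ler1n.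
(* A0 - B0 ln t will bound ln (2 N(t)). In B0, m b comes from the grid and 4 m from the factor eta ^
   2 in the separation threshold of the patterns. *)
pose A0 := ln 2 + m%:R * (ln 2 + 2) + 2 * m%:R * ln (64 * S) + 1 / 2.
pose B0 := m%:R * b + 4 * m%:R.
have l64 : 0 <= ln (64 * S) by rewrite ln_ge0// -[leLHS]mulr1 ler_pM// ler1n.
have A00 : 0 <= A0 by rewrite /A0 !addr_ge0 ?mulr_ge0 ?addr_ge0.
have B00 : 0 <= B0 by rewrite addr_ge0 ?mulr_ge0.
pose pat (th : 'rV[R]_m) (z : borel 'rV[R]_d) : {set X} :=
  [set x : X | `[< I (tag x) (tagged x)
                     (Lam (tag x) (tagged x) th z + a (tag x) (tagged x)) >]]%SET.
have patB th vt z : pat th z = pat vt z -> forall i, B i th z -> B i vt z.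
  move=> /finset.setP patE i Bi l _; have := Bi l Logic.I.
  have := patE (Tagged (fun i => 'I_(s i)) l).
  by rewrite !inE /= => + h; rewrite (asboolT h) => /esym/asboolP.
(* With half-space and point fixed, membership in the pattern is a sign test of an affine function
   of the parameter; the offset [a] joins its constant term. *)
have vc k (f : 'I_k -> X * borel 'rV[R]_d) :
    (forall A : {set 'I_k}, exists2 t, nbh Theta thstar delta t &
       forall j, ((f j).1 \in pat t (f j).2) = (j \in A)) -> (k <= m)%N.
  move=> sh.
  apply: (@halfspaces_shattered_le R m k
    (fun j th => Lam (tag (f j).1) (tagged (f j).1) th (f j).2
                 + a (tag (f j).1) (tagged (f j).1))
    (fun j => I (tag (f j).1) (tagged (f j).1))).
  - move=> j; have [L0 [b1 LE]] := hLam_affine (tag (f j).1) (tagged (f j).1) (f j).2.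
    by exists L0, (b1 + a (tag (f j).1) (tagged (f j).1)) => x; rewrite LE addrA.
  - by move=> j; exact: hI.
  - move=> A; have [t Ut h] := sh A; exists t => j; rewrite -h inE.
    by split => [/asboolT|/asboolP].
pose Xr := r%:R + ln 2 + c_coef m beta e + (5 + 2 * L e) * D.
pose Yr := r%:R + 4 * (1 + L e) * D.
pose c := 2 * Num.sqrt Xr + 2 * Num.sqrt Yr.
have -> : 2 * e * Num.sqrt Xr + 2 * e * Num.sqrt Yr = e * c by rewrite /c; ring.
have lne0 : 0 <= - ln e by rewrite oppr_ge0 ln_le0// ltW.
have Lge : 2 - ln e <= L e by exact: ln_8r_ge.
have L0 : 0 <= L e by apply: le_trans Lge; rewrite addr_ge0.
have D0 : 0 <= D by exact: ler0n.
have Xr0 : 0 <= Xr.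
  rewrite /Xr /c_coef -/(L e) !addr_ge0 ?mulr_ge0 ?addr_ge0 ?mulr_ge0//.
  by rewrite ln_ge0// ler1n.
have r0 : 0 < r%:R :> R by rewrite ltr0n.
have Yr0 : 0 < Yr.
  by rewrite /Yr ltr_pwDl// !mulr_ge0// addr_ge0.
have c0 : 0 < c by rewrite /c ltr_wpDl ?mulr_ge0 ?sqrtr_ge0// mulr_gt0// sqrtr_gt0.
apply: (@le_trans _ _
    (\int[lebesgue_measure]_(t in `]0%R, e]) (Num.sqrt (A0 - B0 * ln t))%:E)%E).
  apply: le_integral_nonmeas => t /=; rewrite in_itv/= => /andP[t0 te].
    (* The Dirac mass at 0 shows that the supremum is over a nonempty set, hence nonnegative. *)
    pose Q : probability (borel 'rV[R]_d) R := \d_(0 : borel 'rV[R]_d).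
    apply: le_trans (sqrte_ge0 _) _; apply: ereal_sup_ubound; exists Q => //.
    exists [set 0]; split => //; first exact: borel_measurable_singleton.
    by rewrite /Q /= diracE mem_set.
  apply: ge_ereal_sup => _ [Q Qfin <-].
  have [n [p [q [q0 q1 normE]]]] :=
    L2norm_finite_support (@borel_measurable_singleton R d) Qfin.
  have t01 : 0 < t <= 1 by rewrite t0 (le_trans te)// ltW.
  have [N [cc [N0 lnN Ucc ccP]]] := finite_cover hthstar hB hbeta hC_pos
    hGi_holder hG' hdelta hBhat p m0 hr X0 patB vc q0 q1 t01.
  apply: (@covering_number_le _ _ _ _ _ _ N) => //; last first.
    apply: le_trans (lerD (lexx _) lnN) _.
    by rewrite le_eqVlt -/b -/X -/S; apply/orP; left; apply/eqP; exact: log_cover_arith.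
  (* Centres must belong to F; the common term [G thstar] cancels in the differences. *)
  exists (fun k z => G (cc k) z - G thstar z); split; first by move=> k; exists (cc k).
  move=> _ [th Uth <-]; have [k hk] := ccP _ Uth; exists k.
  have tT := Uth.1; have kT := (Ucc k).1.
  rewrite !normE//; last by apply: measurable_funB; exact: minc.
  rewrite -EFinM lee_fin -[X in X * _](gtr0_norm t0) -sqrtr_sqr -sqrtrM ?sqr_ge0//.
  rewrite ler_wsqrtr//; apply: le_trans hk.
  by apply: ler_sum => j _; rewrite /= opprB addrA subrK.
apply: integral_sqrt_log_le => //; first by rewrite e0 ltW.
have DE : D = (m%:R + 2) * S by rewrite /D /d_coef natrM natrD /S card_sigma_ord.
have := @entropy_constants_le R r%:R m%:R S b (ln 2) (ln 3) (ln (64 * S)) (L e) (- ln e).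
rewrite -DE => /(_ _ _ _ _ _ _ _ _ _ _) h.
apply: le_trans (h _ _ _ _ _ _ _ _ _ _) _; rewrite ?ler1n//.
- by have := @ln_le_subr1 R 2 (ltr0n _ _); rewrite -[X in X - 1]/(1 + 1) addrK.
- by rewrite ln_ge0// ler1n.
- exact: ln64M_le.
exact: (four_sum_le_sqr Xr0 (ltW Yr0)).
Qed.
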